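(* For $1<\alpha<2$ and $0<\rho<1$, the measure $\nu_{\alpha,\rho}$ has a positive analytic density on $\mathbf{R}$ given by $$\psi_{\alpha,\rho}(x)=\frac1\pi(\sin\theta)^{1+\frac1\alpha}\bigl(\sin[(2-\alpha)\rho\pi+(\alpha-1)\theta]\bigr)^{-\frac1\alpha},$$ where $\theta\in(0,\pi)$ is the only solution of the equation $$x=(\sin\theta)^{-\frac1\alpha}\bigl(\sin[(2-\alpha)\rho\pi+(\alpha-1)\theta]\bigr)^{\frac1\alpha-1}\sin[(2-\alpha)\rho\pi+\alpha\theta].$$ The support of the measure $\nu_{\alpha,0}$ is the interval $(-\infty,\alpha(\alpha-1)^{\frac1\alpha-1}]$, and $\nu_{\alpha,0}$ has an analytic density on this support, given by the formula $$\psi_{\alpha,0}(x)=\frac1\pi(\sin\theta)^{1+\frac1\alpha}(\sin(\alpha-1)\theta)^{-\frac1\alpha},$$ where $\theta\in(0,\pi)$ is the only solution of the equation $$x=(\sin\theta)^{-\frac1\alpha}(\sin(\alpha-1)\theta)^{\frac1\alpha-1}\sin\alpha\theta.$$ Finally, $\nu_{\alpha,1}$ is the image of $\nu_{\alpha,0}$ by the map $t\mapsto-t$.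
   Context: For a Borel probability measure $\mu$ on $\mathbf{R}$ let $G_\mu(z)=\int_{-\infty}^\infty\frac{1}{z-t}\,d\mu(t)$ and $F_\mu=1/G_\mu$ on $\mathbf{C}^+=\{\Im z>0\}$. For every $\eta>0$ there is $M>0$ such that $F_\mu$ has an analytic inverse $F_\mu^{-1}$ on $\Gamma_{\eta,M}=\{x+iy:y>M,|x|<\eta y\}$ with values in $\mathbf{C}^+$ ($F_\mu(F_\mu^{-1}(z))=z$, $F_\mu^{-1}(z)/z\to1$ as $z\to\infty$). The Voiculescu transform is $\phi_\mu(z)=F_\mu^{-1}(z)-z$; it determines $\mu$. For $1<\alpha<2$ and $0\le\rho\le1$, $\nu_{\alpha,\rho}$ denotes the probability measure on $\mathbf{R}$ (stable for free additive convolution) whose Voiculescu transform is $\phi(z)=e^{i(\alpha-2)\rho\pi}z^{-\alpha+1}$, with the principal branch of the power on $\mathbf{C}^+$.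
   Formalization: For ρ=0, the unique θ∈(0,π), the density formula and analyticity are stated only for x strictly below the endpoint α(α−1)^{1/α−1}: at the endpoint the equation has no solution in (0,π) and the density has a square-root singularity. *)

(* Defs.v *)
From HB Require Import structures.
From mathcomp Require Import all_boot all_order all_algebra.
From mathcomp Require Import complex.
From mathcomp Require Import all_classical all_reals all_analysis.

Set Implicit Arguments.
Unset Strict Implicit.
Unset Printing Implicit Defensive.
Import Order.TTheory GRing.Theory Num.Theory.
Import numFieldNormedType.Exports.
Local Open Scope classical_set_scope.
Local Open Scope ring_scope.
Local Open Scope complex_scope.

Section complex_power.
Variable R : realType.
Implicit Types (z : R[i]) (a t : R).

Definition expi t : R[i] := cos t +i* sin t.

(* |z| as a real number; the norm `|z| of R[i] is complex-valued. *)
Definition cmod z : R := complex.Re `|z|.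

(* Principal argument, in ]-pi, pi] for z != 0. *)
Definition Carg z : R :=
  let t := acos (complex.Re z / cmod z) in
  if 0 <= complex.Im z then t else - t.

(* Principal branch of z ^ a, i.e. exp (a (ln |z| + i Carg z)), for z != 0. *)
Definition cpow z a : R[i] := (cmod z `^ a)%:C * expi (a * Carg z).

Definition upper_half_plane : set R[i] := [set z | 0 < complex.Im z].

Definition cone (eta M : R) : set R[i] :=
  [set z | M < complex.Im z /\ `|complex.Re z| < eta * complex.Im z].

(* Complex differentiability at every point of D; this is analyticity when D is
   open. *)
Definition holomorphic_on (D : set R[i]) (f : R[i] -> R[i]) : Prop :=
  forall z, D z -> derivable (f : R[i]^o -> R[i]^o) z 1.

End complex_power.

Section voiculescu.
Variable R : realType.
Implicit Types (nu : probability (measurableTypeR R) R) (z : R[i]).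

(* The integral of a complex-valued function is taken componentwise. *)
Definition cauchy_transform nu z : R[i] :=
  (\int[nu]_t complex.Re (z - t%:C)^-1) +i*
  (\int[nu]_t complex.Im (z - t%:C)^-1).

Definition F_transform nu z : R[i] := (cauchy_transform nu z)^-1.

(* Finv is an analytic right inverse of F_nu on the truncated cone, with values
   in the upper half-plane and Finv z / z --> 1 as z --> oo inside the cone. *)
Definition F_inverse_on nu (eta M : R) (Finv : R[i] -> R[i]) : Prop :=
  [/\ holomorphic_on (cone eta M) Finv,
      forall z, cone eta M z -> upper_half_plane (Finv z),
      forall z, cone eta M z -> F_transform nu (Finv z) = z &
      forall e : R, 0 < e -> exists K : R, forall z,
        cone eta M z -> K < cmod z -> cmod (Finv z / z - 1) < e].

Definition has_voiculescu_transform nu (phi : R[i] -> R[i]) : Prop :=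
  forall eta : R, 0 < eta -> exists2 M : R, 0 < M &
    exists2 Finv : R[i] -> R[i], F_inverse_on nu eta M Finv &
      forall z, cone eta M z -> phi z = Finv z - z.

Definition stable_voiculescu (alpha rho : R) z : R[i] :=
  expi ((alpha - 2) * rho * pi) * cpow z (- alpha + 1).

(* nu is the measure nu_{alpha, rho}; a measure is determined by its Voiculescu
   transform. *)
Definition is_free_stable (alpha rho : R) nu : Prop :=
  has_voiculescu_transform nu (stable_voiculescu alpha rho).

End voiculescu.

Section real_line.
Variable R : realType.
Implicit Types (nu : probability (measurableTypeR R) R) (psi : R -> R).

Definition real_analytic_at psi (x0 : R) : Prop :=
  exists a : R^nat, exists2 r : R, 0 < r &
    forall x, `|x - x0| < r -> pseries a (x - x0) @ \oo --> psi x.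

Definition measure_support nu : set R :=
  [set x | forall U : set R, open U -> U x -> (0 < nu U)%E].

Definition has_density_on nu (D : set R) psi : Prop :=
  [/\ measurable_fun (D : set (measurableTypeR R)) psi,
      forall x, D x -> 0 <= psi x &
      forall A : set (measurableTypeR R), measurable A ->
        nu A = (\int[lebesgue_measure]_(x in A `&` D) (psi x)%:E)%E].

End real_line.

(* Main.v *)
Require Import Defs.
From HB Require Import structures.
From mathcomp Require Import all_boot all_order all_algebra.
From mathcomp Require Import complex.
From mathcomp Require Import all_classical all_reals all_analysis.
From mathcomp Require Import measurable_realfun ring lra.
Set Implicit Arguments.
Unset Strict Implicit.
Unset Printing Implicit Defensive.
Import Order.TTheory GRing.Theory Num.Theory.
Import numFieldNormedType.Exports.
Local Open Scope classical_set_scope.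
Local Open Scope ring_scope.

(** Let c z^(1-alpha), with |c| = 1, be the Voiculescu transform of nu, let
    K(z) = z + c z^(1-alpha), and let G be the Cauchy transform of nu. The
    hypothesis says that G(K(z)) = 1/z for z large in each cone of the upper
    half-plane.

    Fix th in ]0, pi[ and let z = expR u * expi th run along a ray. Then Im K(z)
    increases with u and vanishes at exactly one u = ub th, where K(z) is a real
    number xb th. Both G(K(z)) and 1/z have convergent expansions in powers of
    K - K0 at each point of the ray where Im K > 0 (expansible_cauchy,
    expansible_polar), so G(K(z)) = 1/z on all of that part of the ray
    (inverse_on_ray).

    Now integrate G dK = dK / z. The right-hand side has the elementary primitive
    log z + ((alpha-1)/alpha) c z^(-alpha); on the left, Im (G dK) is the
    differential of the integral of arg (K - t) against nu(dt). Comparing at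
    infinity, where both sides tend to th, gives the value of that integral on
    the whole ray (arg_intE). When K tends to the real point x = xb th, the
    angle arg (K - t) tends to pi for t > x and to 0 for t < x. Hence
    pi * nu(]x, oo[) is the boundary value of the primitive, up to an atom at x
    (survival_sandwich); and atoms are excluded because this boundary value is
    continuous in th while xb is strictly decreasing (survivalE). So the
    survival function of nu is explicit along the curve th -> xb th;
    differentiating it gives the density - Im (1/z) / pi, whose value is
    dens th. The density is analytic because 1/z has a convergent expansion
    in powers of K along the boundary curve too (psi_analytic).

    The expansions rest on a differential equation. As z and c z^(1-alpha) are
    powers, p = 1/z and D = 1/K'(z) satisfy, for the derivation d/dK,
    p' = - p^2 D and D' = - alpha p (D - 1) D^2. Therefore the n-th derivative of
    p is p^(n+1) times a polynomial in D of degree at most 2 n, and its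
    coefficients add up to at most 9^n n! in absolute value (jet_l1norm), which
    makes the Taylor remainders decay geometrically.

    For 0 < rho < 1 the point xb th runs through the whole line. For rho = 0 it
    runs through ]-oo, edge[, and the mass left beyond xb th tends to 0 with th
    (small_tail). The reflection th -> pi - th exchanges rho and 1 - rho, and
    matches the survival functions of the two extreme measures
    (survival_reflect). *)

(** * Complex numbers and differentiable complex curves *)

Notation cRe := (@complex.Re _).
Notation cIm := (@complex.Im _).
Notation normc := (@ComplexField.Normc.normc _).

Section complex_numbers.
Context {R : realType}.
Implicit Types (z w : R[i]) (a b t : R).

Lemma cplxP z w : cRe z = cRe w -> cIm z = cIm w -> z = w.
Proof. by case: z w => [a b] [c d] /= -> ->. Qed.

Lemma cReD z w : cRe (z + w) = cRe z + cRe w.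
Proof. by case: z w => [a b] [c d]. Qed.
Lemma cImD z w : cIm (z + w) = cIm z + cIm w.
Proof. by case: z w => [a b] [c d]. Qed.
Lemma cReN z : cRe (- z) = - cRe z. Proof. by case: z. Qed.
Lemma cImN z : cIm (- z) = - cIm z. Proof. by case: z. Qed.
Lemma cReM z w : cRe (z * w) = cRe z * cRe w - cIm z * cIm w.
Proof. by case: z w => [a b] [c d]. Qed.
Lemma cImM z w : cIm (z * w) = cRe z * cIm w + cIm z * cRe w.
Proof. by case: z w => [a b] [c d]. Qed.
Lemma cReC a : cRe (a%:C)%C = a. Proof. by []. Qed.
Lemma cImC a : cIm (a%:C)%C = 0. Proof. by []. Qed.
Lemma cReV z : cRe z^-1 = cRe z / (cRe z ^+ 2 + cIm z ^+ 2).
Proof. by case: z. Qed.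
Lemma cImV z : cIm z^-1 = - cIm z / (cRe z ^+ 2 + cIm z ^+ 2).
Proof. by case: z => a b /=; rewrite mulNr. Qed.
Lemma cRe_expi t : cRe (expi t) = cos t. Proof. by []. Qed.
Lemma cIm_expi t : cIm (expi t) = sin t. Proof. by []. Qed.

Definition cplxE := (cReD, cImD, cReN, cImN, cReM, cImM, cReC, cImC,
  cRe_expi, cIm_expi).

Lemma cIm_sum (I : Type) (r : seq I) (F : I -> R[i]) :
  cIm (\sum_(i <- r) F i) = \sum_(i <- r) cIm (F i).
Proof.
by elim: r => [|i r ih]; rewrite ?big_nil// !big_cons cImD ih.
Qed.

Lemma normcE z : normc z = Num.sqrt (cRe z ^+ 2 + cIm z ^+ 2).
Proof. by case: z. Qed.

Lemma cmodE z : cmod z = normc z.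
Proof. by rewrite /cmod normc_def normcE. Qed.

Lemma normc_ge0 z : 0 <= normc z.
Proof. by rewrite normcE sqrtr_ge0. Qed.

Lemma normc_gt0 z : (0 < normc z) = (z != 0).
Proof.
rewrite lt_neqAle normc_ge0 andbT eq_sym; congr (~~ _).
apply/eqP/eqP => [/ComplexField.Normc.eq0_normc//|->].
exact: ComplexField.Normc.normc0.
Qed.

Lemma normcM z w : normc (z * w) = normc z * normc w.
Proof. exact: ComplexField.Normc.normcM. Qed.

Lemma normcV z : normc z^-1 = (normc z)^-1.
Proof. exact: ComplexField.Normc.normcV. Qed.

Lemma normcD z w : normc (z + w) <= normc z + normc w.
Proof. exact: le_normcD. Qed.

Lemma normcN z : normc (- z) = normc z.
Proof. exact: complex.normcN. Qed.

Lemma normcB z w : normc (z - w) <= normc z + normc w.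
Proof. by rewrite -(normcN w); exact: normcD. Qed.

Lemma normcC a : normc (a%:C)%C = `|a|.
Proof. by rewrite normcE /= expr0n addr0 sqrtr_sqr. Qed.

Lemma normcX z n : normc (z ^+ n) = normc z ^+ n.
Proof.
elim: n => [|n ih]; last by rewrite !exprS normcM ih.
by rewrite !expr0 ComplexField.Normc.normc1.
Qed.

Lemma normc_expi t : normc (expi t) = 1.
Proof. by rewrite normcE /= cos2Dsin2 sqrtr1. Qed.

Lemma cRe_le_normc z : `|cRe z| <= normc z.
Proof. by rewrite normcE -sqrtr_sqr ler_wsqrtr// lerDl sqr_ge0. Qed.

Lemma cIm_le_normc z : `|cIm z| <= normc z.
Proof. by rewrite normcE -sqrtr_sqr ler_wsqrtr// lerDr sqr_ge0. Qed.

Lemma normc_le_ReIm z : normc z <= `|cRe z| + `|cIm z|.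
Proof.
rewrite normcE -[leRHS]ger0_norm ?addr_ge0// -sqrtr_sqr ler_wsqrtr//.
rewrite sqrrD !real_normK ?num_real// -addrA [_ *+ 2 + _]addrC addrA lerDl.
by rewrite mulrn_wge0// mulr_ge0.
Qed.

Lemma expiD a b : expi (a + b) = expi a * expi b.
Proof. by apply: cplxP; rewrite !cplxE ?cosD ?sinD; ring. Qed.

Lemma expiN_inv t : (expi t)^-1 = expi (- t).
Proof.
by apply: cplxP; rewrite ?cReV ?cImV /= cos2Dsin2 divr1 ?cosN ?sinN.
Qed.

Lemma cIm_neq0 z : 0 < cIm z -> z != 0.
Proof. by apply: contraTneq => ->; rewrite ltxx. Qed.

End complex_numbers.

Section curve_derivatives.
Context {R : realType}.
Implicit Types (f g : R -> R) (F G : R -> R[i]) (s a b : R).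

Lemma drvD f g s a b : is_derive s 1 f a -> is_derive s 1 g b ->
  is_derive s 1 (fun t => f t + g t) (a + b).
Proof. by move=> fa gb; exact: (is_deriveD fa gb). Qed.

Lemma drvB f g s a b : is_derive s 1 f a -> is_derive s 1 g b ->
  is_derive s 1 (fun t => f t - g t) (a - b).
Proof. by move=> fa gb; exact: (is_deriveB fa gb). Qed.

Lemma drvM f g s a b : is_derive s 1 f a -> is_derive s 1 g b ->
  is_derive s 1 (fun t => f t * g t) (a * g s + f s * b).
Proof.
move=> fa gb; have h := is_deriveM fa gb; apply: is_derive_eq h _.
by rewrite /GRing.scale /= addrC [g s * a]mulrC.
Qed.

Lemma drv_eq f s a b : is_derive s 1 f a -> a = b -> is_derive s 1 f b.
Proof. by move=> ? <-. Qed.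

Lemma drvc a s : is_derive s 1 (fun _ : R => a) 0.
Proof. exact: is_derive_cst. Qed.

Lemma drvV f s a : f s != 0 -> is_derive s 1 f a ->
  is_derive s 1 (fun t => (f t)^-1) (- a / f s ^+ 2).
Proof.
move=> fs fa; have h := is_deriveV fs fa; apply: is_derive_eq h _.
by rewrite /GRing.scale /= mulNr mulNr mulrC.
Qed.

Lemma drv_comp f g s a b : is_derive (g s) 1 f a -> is_derive s 1 g b ->
  is_derive s 1 (fun t => f (g t)) (a * b).
Proof. by move=> fa gb; exact: (is_derive1_comp fa gb). Qed.

(** Complex curves are differentiated componentwise. *)
Definition cderive F s (l : R[i]) :=
  is_derive s 1 (fun t => cRe (F t)) (cRe l) /\
  is_derive s 1 (fun t => cIm (F t)) (cIm l).

Lemma cderive_eq F s l m : cderive F s l -> l = m -> cderive F s m.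
Proof. by move=> ? <-. Qed.

Lemma cderiveD F G s l m : cderive F s l -> cderive G s m ->
  cderive (fun t => F t + G t) s (l + m).
Proof.
move=> [F1 F2] [G1 G2]; split; rewrite cplxE.
- by under eq_fun do rewrite cplxE; exact: drvD.
- by under eq_fun do rewrite cplxE; exact: drvD.
Qed.

Lemma cderiveM F G s l m : cderive F s l -> cderive G s m ->
  cderive (fun t => F t * G t) s (l * G s + F s * m).
Proof.
move=> [F1 F2] [G1 G2]; split; rewrite !cplxE.
- under eq_fun do rewrite cplxE.
  by apply: (drv_eq (drvB (drvM F1 G1) (drvM F2 G2))); ring.
- under eq_fun do rewrite cplxE.
  by apply: (drv_eq (drvD (drvM F1 G2) (drvM F2 G1))); ring.
Qed.

Lemma cderive_cst c s : cderive (fun _ => c) s 0.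
Proof. by split; exact: drvc. Qed.

Lemma cderive_Z c F s l : cderive F s l ->
  cderive (fun t => c * F t) s (c * l).
Proof.
move=> Fl; apply: cderive_eq; first exact: (cderiveM (cderive_cst c s) Fl).
by rewrite mul0r add0r.
Qed.

Lemma cderiveN F s l : cderive F s l -> cderive (fun t => - F t) s (- l).
Proof.
move=> Fl; have -> : (fun t => - F t) = (fun t => -1 * F t).
  by apply/funext => t; rewrite mulN1r.
by rewrite -(mulN1r l); exact: cderive_Z.
Qed.

Lemma cderiveV F s l : F s != 0 -> cderive F s l ->
  cderive (fun t => (F t)^-1) s (- l / F s ^+ 2).
Proof.
move=> Fs [F1 F2].
have n0 : cRe (F s) ^+ 2 + cIm (F s) ^+ 2 != 0.
  apply: contra Fs; rewrite paddr_eq0 ?sqr_ge0// !sqrf_eq0 => /andP[/eqP a /eqP b].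
  by apply/eqP; apply: cplxP.
have dn := drvV (f := fun t => cRe (F t) ^+ 2 + cIm (F t) ^+ 2) n0
  (drvD (drvM F1 F1) (drvM F2 F2)).
have [r i] : cRe (- l / F s ^+ 2) = (- cRe l * (cRe (F s) ^+ 2 - cIm (F s) ^+ 2)
    - 2 * cIm l * cRe (F s) * cIm (F s)) / (cRe (F s) ^+ 2 + cIm (F s) ^+ 2) ^+ 2
  /\ cIm (- l / F s ^+ 2) = (- cIm l * (cRe (F s) ^+ 2 - cIm (F s) ^+ 2)
    + 2 * cRe l * cRe (F s) * cIm (F s)) / (cRe (F s) ^+ 2 + cIm (F s) ^+ 2) ^+ 2.
  rewrite [in X in X /\ _]cReM [in X in _ /\ X]cImM cReV cImV [F s ^+ 2]expr2.
  rewrite !cplxE.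
  move: n0; set x := cRe (F s); set y := cIm (F s) => n0.
  have -> : (x * x - y * y) ^+ 2 + (x * y + y * x) ^+ 2 = (x ^+ 2 + y ^+ 2) ^+ 2.
    by ring.
  by split; field; rewrite n0.
split.
- under eq_fun do rewrite cReV.
  apply: (drv_eq (drvM F1 dn)); rewrite r.
  by move: n0; set x := cRe (F s); set y := cIm (F s) => n0; field; rewrite ?n0.
- under eq_fun do rewrite cImV -mulN1r -mulrA.
  apply: (drv_eq (drvM (drvc (-1) s) (drvM F2 dn))); rewrite i.
  by move: n0; set x := cRe (F s); set y := cIm (F s) => n0; field; rewrite ?n0.
Qed.

End curve_derivatives.

(** * Mean value inequality, and the derivatives of the inverse branch *)

Section mean_value.
Context {R : realType}.
Implicit Types (f : R -> R) (F : R -> R[i]) (s a b : R).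

Lemma drv_continuous f s a : is_derive s 1 f a -> {for s, continuous f}.
Proof. by move=> [df _]; exact/differentiable_continuous/derivable1_diffP. Qed.

Lemma drv_within f (df : R -> R) a b :
  (forall s, a <= s <= b -> is_derive s 1 f (df s)) ->
  {within `[a, b], continuous f}.
Proof.
move=> dfE; apply: continuous_in_subspaceT => x /set_mem /=.
by rewrite in_itv /= => xab; exact: drv_continuous (dfE _ xab).
Qed.

Lemma drv_MVT f (df : R -> R) a b : a <= b ->
  (forall s, a <= s <= b -> is_derive s 1 f (df s)) ->
  exists2 c, a <= c <= b & f b - f a = df c * (b - a).
Proof.
move=> ab dfE; have dfo x : x \in `]a, b[ -> is_derive x 1 f (df x).
  by rewrite in_itv /= => /andP[ax xb]; apply: dfE; rewrite !ltW.
have [c] := MVT_segment ab dfo (drv_within dfE).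
by rewrite in_itv /= => ? ?; exists c.
Qed.

Lemma drv_mvt f (df : R -> R) a b C :
  (forall s, `|s - a| <= `|b - a| -> is_derive s 1 f (df s)) ->
  (forall s, `|s - a| <= `|b - a| -> `|df s| <= C) ->
  `|f b - f a| <= C * `|b - a|.
Proof.
move=> dfE dfC.
have [ab|/ltW ba] := leP a b.
- have inE s : a <= s <= b -> `|s - a| <= `|b - a|.
    by move=> /andP[? ?]; rewrite !ger0_norm ?subr_ge0// lerD2r.
  have [c /inE cab ->] := drv_MVT ab (fun s sab => dfE s (inE s sab)).
  by rewrite normrM ler_wpM2r// dfC.
- have inE s : b <= s <= a -> `|s - a| <= `|b - a|.
    by move=> /andP[? ?]; rewrite !ler0_norm ?subr_le0// lerN2 lerD2r.
  have [c /inE cab h] := drv_MVT ba (fun s sab => dfE s (inE s sab)).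
  by rewrite distrC h normrM [`|a - b|]distrC ler_wpM2r// dfC.
Qed.

Lemma cderive_mvt F (dF : R -> R[i]) a b C :
  (forall s, `|s - a| <= `|b - a| -> cderive F s (dF s)) ->
  (forall s, `|s - a| <= `|b - a| -> normc (dF s) <= C) ->
  normc (F b - F a) <= 2 * C * `|b - a|.
Proof.
move=> dFE dFC; apply: (le_trans (normc_le_ReIm _)); rewrite !cplxE.
rewrite mulr_natl mulr2n mulrDl; apply: lerD.
- apply: (@drv_mvt (fun t => cRe (F t)) (fun t => cRe (dF t))) => s sab.
    by have [] := dFE _ sab.
  exact: le_trans (cRe_le_normc _) (dFC _ sab).
- apply: (@drv_mvt (fun t => cIm (F t)) (fun t => cIm (dF t))) => s sab.
    by have [] := dFE _ sab.
  exact: le_trans (cIm_le_normc _) (dFC _ sab).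
Qed.

Lemma cderiveX F s l n : cderive F s l ->
  cderive (fun t => F t ^+ n) s (n%:R * F s ^+ n.-1 * l).
Proof.
move=> Fl; elim: n => [|n ih].
  have -> : 0%:R * F s ^+ 0.-1 * l = 0 by rewrite !mul0r.
  exact: cderive_cst.
under eq_fun do rewrite exprS.
apply: (cderive_eq (cderiveM Fl ih)).
case: n {ih} => [|n]; first by rewrite /= expr0; ring.
by rewrite /= !exprS; ring.
Qed.

End mean_value.

Section jets.
Context {R : realType}.
Variable beta : R.
Implicit Types (n k : nat) (l : seq (R * nat)) (p D : R[i]).

(** A polynomial in D is a list of pairs (coefficient, exponent), on which the
    derivation below acts term by term. *)
Definition lpoly l D : R[i] := \sum_(ck <- l) (ck.1)%:C%C * D ^+ ck.2.

(** The derivation with p |-> - p^2 D and D |-> - (beta + 1) p (D - 1) D^2, applied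
    to p^(n+1) c D^k and divided by p^(n+2). *)
Definition jet_term n (ck : R * nat) : seq (R * nat) :=
  [:: (((beta + 1) * ck.2%:R - n.+1%:R) * ck.1, ck.2.+1);
      (- ((beta + 1) * ck.2%:R) * ck.1, ck.2.+2)].

Definition jet_step n l := flatten [seq jet_term n ck | ck <- l].

Fixpoint jet n := if n is m.+1 then jet_step m (jet m) else [:: (1 : R, 0%N)].

Definition jetval n p D := p ^+ n.+1 * lpoly (jet n) D.

Lemma lpoly_cons ck l D : lpoly (ck :: l) D = (ck.1)%:C%C * D ^+ ck.2 + lpoly l D.
Proof. by rewrite /lpoly big_cons. Qed.

Lemma jet0 p D : jetval 0 p D = p.
Proof. by rewrite /jetval /lpoly /= big_seq1 expr0 expr1 mulr1 mulr1. Qed.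

(** With v the velocity of w, the hypotheses are the two differential equations
    dp/dw = - p^2 D and dD/dw = - (beta + 1) p (D - 1) D^2 along a curve; jetval n
    is then the n-th derivative of p with respect to w. *)
Lemma cderive_jet (p D : R -> R[i]) (s : R) (v : R[i]) n :
  cderive p s (- p s ^+ 2 * D s * v) ->
  cderive D s (- ((beta + 1)%:C)%C * p s * (D s - 1) * D s ^+ 2 * v) ->
  cderive (fun t => jetval n (p t) (D t)) s (jetval n.+1 (p s) (D s) * v).
Proof.
move=> dp dD; rewrite /jetval /=; elim: (jet n) => [|[c k] l ih].
  under eq_fun do rewrite /lpoly big_nil mulr0.
  by rewrite /jet_step /lpoly /= big_nil mulr0 mul0r; exact: cderive_cst.
under eq_fun do rewrite lpoly_cons /= mulrDr.
rewrite /jet_step /= -/(jet_step n l) !lpoly_cons addrA mulrDr mulrDl.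
apply: cderiveD => //.
apply: (cderive_eq (cderiveM (cderiveX n.+1 dp)
  (cderive_Z (c%:C)%C (cderiveX k dD)))).
rewrite /= !rmorphM !rmorphD !rmorphN /= !rmorphM /= !rmorphD /= !rmorph_nat !rmorph1.
case: k => [|k] /=.
  by rewrite !mulr0 !mul0r !mulr0 !addr0 !expr0 !exprS expr0; ring.
by rewrite !exprS; ring.
Qed.

Definition l1norm l : R := \sum_(ck <- l) `|ck.1|.

Lemma lpoly_bound l d (D : R[i]) (B : R) : 1 <= B -> normc D <= B ->
  all (fun ck => (ck.2 <= d)%N) l -> normc (lpoly l D) <= l1norm l * B ^+ d.
Proof.
move=> B1 DB; elim: l => [|[c k] l ih] /=.
  by rewrite /lpoly /l1norm !big_nil mul0r ComplexField.Normc.normc0.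
move=> /andP[kd /ih {}ih]; rewrite lpoly_cons /l1norm big_cons mulrDl.
apply: (le_trans (normcD _ _)); apply: lerD => //=.
rewrite normcM normcC normcX ler_wpM2l//.
apply: (@le_trans _ _ (B ^+ k)); first by rewrite lerXn2r ?nnegrE ?normc_ge0// (le_trans ler01).
by rewrite ler_weXn2l.
Qed.

Lemma jet_degree n : all (fun ck => (ck.2 <= n.*2)%N) (jet n).
Proof.
elim: n => //= n; elim: (jet n) => //= [[c k]] l ih /andP[/= kn /ih {}ih].
rewrite /jet_step /= -/(jet_step n l) ih andbT doubleS !ltnS kn andbT.
exact: leq_trans kn _.
Qed.

Hypotheses (beta0 : 0 <= beta) (beta1 : beta <= 1).

(** A term of exponent k <= 2 n yields two terms whose coefficients add up to at
    most n + 1 + 2 (beta + 1) k <= 9 (n + 1) times its own. *)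
Lemma jet_l1norm n : l1norm (jet n) <= n`!%:R * 9 ^+ n.
Proof.
elim: n => [|n ih]; first by rewrite /l1norm big_seq1 /= normr1 fact0 expr0 mulr1.
suff step l : all (fun ck => (ck.2 <= n.*2)%N) l ->
    l1norm (jet_step n l) <= 9 * n.+1%:R * l1norm l.
  apply: (le_trans (step _ (jet_degree n))).
  rewrite factS natrM exprS.
  have : (0 : R) <= 9 * n.+1%:R by rewrite mulr_ge0.
  by move=> /ler_wpM2l /(_ _ _ ih) /le_trans; apply; rewrite le_eqVlt; apply/orP; left; apply/eqP; ring.
elim: l => [|[c k] l ihl] /=; first by rewrite /l1norm !big_nil mulr0.
move=> /andP[kn /ihl {}ihl].
rewrite /jet_step /= -/(jet_step n l) /l1norm !big_cons /= addrA mulrDr.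
apply: lerD => //.
rewrite !normrM -mulrDl ler_wpM2r//.
have kR : (k%:R : R) <= n%:R * 2 by rewrite -natrM ler_nat muln2.
have k0 : (0 : R) <= k%:R by [].
have : 0 <= (beta + 1) * k%:R by rewrite mulr_ge0// addr_ge0.
have : (beta + 1) * k%:R <= 2 * k%:R by apply: ler_wpM2r => //; rewrite -lerBrDr; apply: (le_trans beta1); lra.
move=> h1 h2; rewrite normrN (ger0_norm h2).
have := ler_normB ((beta + 1) * k%:R) (n.+1%:R).
rewrite (ger0_norm h2) (ger0_norm (ler0n _ _)) => h3.
have : (0 : R) <= n%:R by [].
move: h3; rewrite -natr1; lra.
Qed.

Lemma jetval_bound n p D (B : R) : 1 <= B -> normc p <= B -> normc D <= B ->
  normc (jetval n p D) <= n`!%:R * 9 ^+ n * B ^+ (3 * n).+1.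
Proof.
move=> B1 pB DB; have B0 : 0 <= B := le_trans ler01 B1.
rewrite /jetval normcM normcX.
apply: (@le_trans _ _ (B ^+ n.+1 * (l1norm (jet n) * B ^+ n.*2))).
  apply: ler_pM; rewrite ?exprn_ge0 ?normc_ge0//.
    by rewrite lerXn2r ?nnegrE ?normc_ge0.
  exact: lpoly_bound (jet_degree n).
rewrite mulrCA -exprD.
rewrite (_ : (n.+1 + n.*2)%N = (3 * n).+1); last first.
  by rewrite -muln2 mulnC addSn; congr S; rewrite !mulSn addnA addn0.
by rewrite ler_wpM2r ?exprn_ge0 ?jet_l1norm.
Qed.

End jets.

(** * Expansions along a curve *)

Section expansions.
Context {R : realType}.
Variable beta : R.
Hypotheses (beta0 : 0 <= beta) (beta1 : beta <= 1).
Implicit Types (p D v w f : R -> R[i]) (s : R).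

(** The Taylor polynomial of p at the point w s, evaluated at z1. *)
Definition taylor N p D w (z1 : R[i]) s : R[i] :=
  \sum_(n < N) (n`!%:R^-1 * jetval beta n (p s) (D s)) * (z1 - w s) ^+ n.

(** In the derivative with respect to the base point the sum telescopes. *)
Lemma cderive_taylor N p D v w z1 s :
  cderive w s (v s) ->
  cderive p s (- p s ^+ 2 * D s * v s) ->
  cderive D s (- ((beta + 1)%:C)%C * p s * (D s - 1) * D s ^+ 2 * v s) ->
  cderive (taylor N.+1 p D w z1) s
    (N`!%:R^-1 * jetval beta N.+1 (p s) (D s) * v s * (z1 - w s) ^+ N).
Proof.
move=> dw dp dD; elim: N => [|N ih].
  rewrite /taylor; under eq_fun do rewrite big_ord_recl big_ord0 addr0 expr0 mulr1.
  apply: (cderive_eq (cderive_Z _ (cderive_jet 0 dp dD))).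
  by rewrite expr0 mulr1 mulrA.
rewrite /taylor; under eq_fun do rewrite big_ord_recr /=.
have dj := cderive_Z (N.+1`!%:R^-1) (cderive_jet N.+1 dp dD).
have dx := cderiveX N.+1 (cderiveD (cderive_cst z1 s) (cderiveN dw)).
apply: (cderive_eq (cderiveD ih (cderiveM dj dx))).
have -> : N`!%:R^-1 = N.+1%:R * N.+1`!%:R^-1 :> R[i].
  by rewrite factS natrM invfM mulrA divff ?mul1r.
by rewrite /= !exprS; ring.
Qed.

(** Move the base point of the Taylor polynomial from s1, where it equals p s1, to
    s0: the error is the integral of the telescoped derivative. The curve w need
    not be straight, so |w s1 - w s| is estimated by the length of the curve. *)
Lemma taylor_curve p D v w (s0 h B W s1 : R) N :
  1 <= B ->
  (forall s, `|s - s0| < h ->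
    [/\ cderive w s (v s),
        cderive p s (- p s ^+ 2 * D s * v s),
        cderive D s (- ((beta + 1)%:C)%C * p s * (D s - 1) * D s ^+ 2 * v s) &
        [/\ normc (p s) <= B, normc (D s) <= B & normc (v s) <= W]]) ->
  `|s1 - s0| < h ->
  normc (p s1 - taylor N p D w (w s1) s0)
    <= B * (72 * B ^+ 3 * W * `|s1 - s0|) ^+ N.
Proof.
move=> B1 H s1h; have B0 : 0 <= B := le_trans ler01 B1.
case: N => [|N].
  rewrite /taylor big_ord0 subr0 expr0 mulr1.
  by have [_ _ _ []] := H _ s1h.
have W0 : 0 <= W.
  have [_ _ _ [_ _ vW]] := H _ s1h; exact: le_trans (normc_ge0 _) vW.
have near s : `|s - s0| <= `|s1 - s0| -> `|s - s0| < h.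
  by move=> /le_lt_trans; apply.
set d := `|s1 - s0|; have d0 : 0 <= d := normr_ge0 _.
have wd s : `|s - s0| <= d -> normc (w s1 - w s) <= 4 * W * d.
  move=> sd; have -> : w s1 - w s = (w s1 - w s0) - (w s - w s0) by ring.
  apply: (le_trans (normcB _ _)).
  have -> : 4 * W * d = 2 * W * d + 2 * W * d by ring.
  apply: lerD.
    apply: (@cderive_mvt _ w v) => t td; first by have [] := H _ (near _ td).
    by have [_ _ _ []] := H _ (near _ td).
  apply: (@le_trans _ _ (2 * W * `|s - s0|)); last first.
    by rewrite ler_wpM2l// mulr_ge0.
  apply: (@cderive_mvt _ w v) => t td.
    by have [] := H _ (near _ (le_trans td sd)).
  by have [_ _ _ []] := H _ (near _ (le_trans td sd)).
have T1 : taylor N.+1 p D w (w s1) s1 = p s1.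
  rewrite /taylor big_ord_recl /= jet0 expr0 mulr1 big1 ?addr0.
    by rewrite fact0 invr1 mul1r.
  by move=> i _; rewrite subrr expr0n /= mulr0.
rewrite -[X in normc (X - _)]T1.
pose C := N.+1%:R * 9 ^+ N.+1 * B ^+ (3 * N.+1).+1 * W * (4 * W * d) ^+ N.
apply: (@le_trans _ _ (2 * C * d)).
  apply: (@cderive_mvt _ (taylor N.+1 p D w (w s1)) (fun s =>
    N`!%:R^-1 * jetval beta N.+1 (p s) (D s) * v s * (w s1 - w s) ^+ N)) => s sd.
    by have [? ? ? _] := H _ (near _ sd); exact: cderive_taylor.
  have [_ _ _ [pB DB vW]] := H _ (near _ sd).
  rewrite 3!normcM normcX normcV -(rmorph_nat (real_complex R)) normcC normr_nat.
  rewrite /C; apply: ler_pM; rewrite ?exprn_ge0 ?mulr_ge0 ?invr_ge0 ?normc_ge0//.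
    apply: ler_pM; rewrite ?exprn_ge0 ?mulr_ge0 ?invr_ge0 ?normc_ge0//.
    rewrite ler_pdivrMl ?ltr0n ?fact_gt0//.
    apply: (le_trans (jetval_bound beta0 beta1 N.+1 B1 pB DB)).
    by rewrite factS natrM !mulrA [N`!%:R * _]mulrC.
  by rewrite lerXn2r ?nnegrE ?normc_ge0 ?mulr_ge0// wd.
(* 72 = 8 * 9, and N.+1 * (2 * 4 ^ N) <= 8 ^ N.+1. *)
have -> : 2 * C * d = (N.+1%:R * (2 * 4 ^+ N)) * (B * (9 * B ^+ 3 * W * d) ^+ N.+1).
  by rewrite /C [B ^+ (3 * _).+1]exprS [B ^+ (3 * _)]exprM !exprMn !exprS; ring.
have -> : B * (72 * B ^+ 3 * W * d) ^+ N.+1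
    = 8 ^+ N.+1 * (B * (9 * B ^+ 3 * W * d) ^+ N.+1).
  rewrite [RHS]mulrCA -exprMn; congr (_ * _ ^+ _); ring.
apply: ler_wpM2r; first by rewrite mulr_ge0// exprn_ge0// !mulr_ge0// exprn_ge0.
have -> : (8 : R) ^+ N.+1 = 2 ^+ N.+1 * (4 * 4 ^+ N).
  by rewrite -exprS -exprMn; congr (_ ^+ _); ring.
have h4 : (0 : R) <= 4 ^+ N by rewrite exprn_ge0.
apply: ler_pM; rewrite ?mulr_ge0//; last by rewrite ler_wpM2r//; lra.
by rewrite -natrX ler_nat ltnW// ltn_expl.
Qed.

(** The germ of f at s0 is the sum of a power series in w - w s0, with geometric
    control of the remainders. *)
Definition expansible w f s0 := exists (e : nat -> R[i]) (C L d : R),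
  [/\ 0 < d, 0 <= C, 0 <= L & forall s N, `|s - s0| < d ->
    normc (f s - \sum_(n < N) e n * (w s - w s0) ^+ n) <= C * (L * `|s - s0|) ^+ N].

Lemma expansible_curve p D v w (s0 h B W : R) :
  1 <= B -> 0 < h ->
  (forall s, `|s - s0| < h ->
    [/\ cderive w s (v s),
        cderive p s (- p s ^+ 2 * D s * v s),
        cderive D s (- ((beta + 1)%:C)%C * p s * (D s - 1) * D s ^+ 2 * v s) &
        [/\ normc (p s) <= B, normc (D s) <= B & normc (v s) <= W]]) ->
  expansible w p s0.
Proof.
move=> B1 h0 H; exists (fun n => n`!%:R^-1 * jetval beta n (p s0) (D s0)).
exists B, (72 * B ^+ 3 * W), h; split => //.
- exact: le_trans B1.
- have W0 : 0 <= W.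
    have [|_ _ _ [_ _ vW]] := H s0; first by rewrite subrr normr0.
    exact: le_trans (normc_ge0 _) vW.
  by apply: mulr_ge0 => //; apply: mulr_ge0 => //; rewrite exprn_ge0// (le_trans ler01).
- by move=> s N sh; exact: (taylor_curve N B1 H sh).
Qed.

(** An expansion is determined by the values on one side of the point, because
    its coefficients can be recovered one after the other: w s - w s0 is of exact
    order s - s0 there, so the first difference e n - e' n would dominate. *)
Lemma expansible_unique w f g s0 (d k : R) :
  expansible w f s0 -> expansible w g s0 -> 0 < d -> 0 < k ->
  (forall s, s0 < s < s0 + d -> k * `|s - s0| <= normc (w s - w s0)) ->
  (forall s, s0 < s < s0 + d -> f s = g s) ->
  exists2 r, 0 < r & forall s, `|s - s0| < r -> f s = g s.
Proof.
move=> [e [C [L [r [r0 C0 L0 He]]]]] [e' [C' [L' [r' [r'0 C'0 L'0 He']]]]] d0 k0 kw fg.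
have ee' : forall n, e n = e' n.
  elim/ltn_ind => n IH; apply/eqP; rewrite -subr_eq0; apply/negPn/negP.
  rewrite -normc_gt0 => en0.
  pose K := C * L ^+ n.+1 + C' * L' ^+ n.+1.
  have K0 : 0 <= K by rewrite addr_ge0// mulr_ge0// exprn_ge0.
  pose m := normc (e n - e' n) * k ^+ n.
  have m0 : 0 < m by rewrite mulr_gt0// exprn_gt0.
  (* at distance t the term of order n is at least m t^n, while the two
     remainders add up to at most K t^(n+1) *)
  pose t := Num.min (m / (2 * (K + 1))) (Num.min (d / 2) (Num.min (r / 2) (r' / 2))).
  have t0 : 0 < t by rewrite !lt_min !divr_gt0//; rewrite mulr_gt0//; lra.
  have [tK [td [tr tr']]] : t <= m / (2 * (K + 1)) /\ t <= d / 2 /\ t <= r / 2 /\ t <= r' / 2.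
    have := lexx t; rewrite {2}/t !le_min => /andP[-> /andP[-> /andP[-> ->]]] //.
  have ts : `|s0 + t - s0| = t by rewrite addrAC subrr add0r gtr0_norm.
  have sd : s0 < s0 + t < s0 + d by apply/andP; split; lra.
  have h1 : `|s0 + t - s0| < r by rewrite ts; lra.
  have h2 : `|s0 + t - s0| < r' by rewrite ts; lra.
  have := He _ n.+1 h1; have := He' _ n.+1 h2.
  rewrite ts !big_ord_recr /= (fg _ sd).
  have -> : \sum_(i < n) e i * (w (s0 + t) - w s0) ^+ i
      = \sum_(i < n) e' i * (w (s0 + t) - w s0) ^+ i.
    by apply: eq_bigr => i _; rewrite IH.
  set S := \sum_(i < n) _; set z := w (s0 + t) - w s0 => a b.
  have := lerD a b => {a b}.
  have := normcB (g (s0 + t) - (S + e' n * z ^+ n)) (g (s0 + t) - (S + e n * z ^+ n)).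
  have -> : g (s0 + t) - (S + e' n * z ^+ n) - (g (s0 + t) - (S + e n * z ^+ n))
     = (e n - e' n) * z ^+ n by ring.
  move=> /le_trans a /a {a}.
  rewrite normcM normcX => a.
  have : m * t ^+ n <= K * t ^+ n.+1.
    apply: (@le_trans _ _ (normc (e n - e' n) * normc z ^+ n)).
      rewrite /m -mulrA -exprMn ler_wpM2l ?normc_ge0//.
      rewrite lerXn2r ?nnegrE ?normc_ge0// ?mulr_ge0//; [exact: ltW|exact: ltW|].
      by have := kw _ sd; rewrite ts.
    by apply: (le_trans a); rewrite /K mulrDl !exprMn addrC -!mulrA.
  rewrite exprS [K * _]mulrA ler_pM2r ?exprn_gt0//.
  have : K * t <= K * (m / (2 * (K + 1))) by rewrite ler_wpM2l.
  have -> : K * (m / (2 * (K + 1))) = m * (K / (2 * (K + 1))).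
    by field; rewrite gt_eqF//; lra.
  have : K / (2 * (K + 1)) <= 1 / 2 by rewrite ler_pdivrMr; lra.
  move=> /(ler_wpM2l (ltW m0)); lra.
exists (Num.min (Num.min r r') (1 / (2 * (L + L' + 1)))).
  by rewrite !lt_min r0 r'0 /= divr_gt0//; lra.
move=> s; rewrite !lt_min => /andP[/andP[sr sr'] sL].
apply/eqP; rewrite -subr_eq0 -[_ == 0]negbK -normc_gt0; apply/negP => fg0.
set q := (L + L') * `|s - s0|.
have q0 : 0 <= q by rewrite mulr_ge0// addr_ge0.
have q1 : q <= 1 / 2.
  move: sL; rewrite ltr_pdivlMr; last lra.
  rewrite /q; have : 0 <= `|s - s0| by []; nra.
have bnd N : normc (f s - g s) <= (C + C') * 2^-1 ^+ N.
  have := lerD (He s N sr) (He' s N sr').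
  under eq_bigr do rewrite ee'.
  set S := \sum_(i < N) _.
  have := normcB (f s - S) (g s - S).
  have -> : f s - S - (g s - S) = f s - g s by ring.
  move=> /le_trans a /a {}a; apply: (le_trans a); rewrite mulrDl.
  have sL0 : 0 <= L * `|s - s0| by rewrite mulr_ge0.
  have sL'0 : 0 <= L' * `|s - s0| by rewrite mulr_ge0.
  have qE : L * `|s - s0| + L' * `|s - s0| <= 1 / 2 by rewrite -mulrDl.
  by apply: lerD; apply: ler_wpM2l => //; rewrite lerXn2r ?nnegrE//; lra.
have : (C + C') * (2^-1 : R) ^+ N @[N --> \oo] --> (C + C') * 0.
  by apply: cvgMr; apply: cvg_expr; rewrite gtr0_norm ?invf_lt1//; lra.
rewrite mulr0 => /cvgrPdist_lt /(_ _ fg0) [N _ /(_ N (leqnn N))] /=.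
rewrite sub0r normrN ger0_norm; last by rewrite mulr_ge0 ?exprn_ge0 ?addr_ge0.
by rewrite ltNge bnd.
Qed.

End expansions.

(** * The Cauchy transform *)

Section cauchy_transform.
Context {R : realType}.
Variable nu : probability (measurableTypeR R) R.
Implicit Types (f g : measurableTypeR R -> R) (F G : measurableTypeR R -> R[i]).

Lemma bounded_integrable f (C : R) : measurable_fun setT f ->
  (forall t, `|f t| <= C) -> nu.-integrable setT (EFin \o f).
Proof.
move=> mf fC; apply: (le_integrable measurableT (g := EFin \o cst C)).
- exact/measurable_EFinP.
- by move=> t _ /=; rewrite lee_fin (le_trans (fC t))// ler_norm.
- exact: (finite_measure_integrable_cst nu C measurableT).
Qed.

Lemma Rintegral_bound f (C : R) : measurable_fun setT f ->
  (forall t, `|f t| <= C) -> `|\int[nu]_t f t| <= C.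
Proof.
move=> mf fC; have fi := bounded_integrable mf fC.
apply: (le_trans (le_normr_Rintegral measurableT fi)).
have -> : C = \int[nu]_t (cst C t).
  rewrite Rintegral_cst//= [X in fine X](_ : _ = 1%E) ?mulr1//.
  exact: probability_setT.
apply: le_Rintegral => //.
- exact: integrable_norm fi.
- exact: (finite_measure_integrable_cst nu C measurableT).
Qed.

Definition Cint F : R[i] := ((\int[nu]_t cRe (F t)) +i* (\int[nu]_t cIm (F t)))%C.

Lemma cRe_Cint F : cRe (Cint F) = \int[nu]_t cRe (F t). Proof. by []. Qed.
Lemma cIm_Cint F : cIm (Cint F) = \int[nu]_t cIm (F t). Proof. by []. Qed.

(** Bounded measurable complex functions; all integrands below are of this
    kind, so that no integrability question arises. *)
Definition bmeas F := [/\ measurable_fun setT (fun t => cRe (F t)),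
  measurable_fun setT (fun t => cIm (F t)) &
  exists C : R, forall t, normc (F t) <= C].

Lemma bmeas_int F : bmeas F ->
  nu.-integrable setT (EFin \o (fun t => cRe (F t))) /\
  nu.-integrable setT (EFin \o (fun t => cIm (F t))).
Proof.
move=> [mr mi [C FC]]; split; apply: (bounded_integrable (C := C)) => // t.
- exact: le_trans (cRe_le_normc _) (FC t).
- exact: le_trans (cIm_le_normc _) (FC t).
Qed.

Lemma bmeasD F G : bmeas F -> bmeas G -> bmeas (fun t => F t + G t).
Proof.
move=> [Fr Fi [C FC]] [Gr Gi [D GD]]; split.
- by under eq_fun do rewrite cReD; exact: measurable_funD.
- by under eq_fun do rewrite cImD; exact: measurable_funD.
- by exists (C + D) => t; apply: (le_trans (normcD _ _)); exact: lerD.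
Qed.

Lemma bmeasM F G : bmeas F -> bmeas G -> bmeas (fun t => F t * G t).
Proof.
move=> [Fr Fi [C FC]] [Gr Gi [D GD]]; split.
- under eq_fun do rewrite cReM.
  by apply: measurable_funB; exact: measurable_funM.
- under eq_fun do rewrite cImM.
  by apply: measurable_funD; exact: measurable_funM.
- by exists (C * D) => t; rewrite normcM; apply: ler_pM; rewrite ?normc_ge0.
Qed.

Lemma bmeas_cst (c : R[i]) : bmeas (fun _ => c).
Proof. by split => //; exists (normc c). Qed.

Lemma bmeasX F n : bmeas F -> bmeas (fun t => F t ^+ n).
Proof.
move=> mF; elim: n => [|n ih].
  by under eq_fun do rewrite expr0; exact: bmeas_cst.
by under eq_fun do rewrite exprS; exact: bmeasM.
Qed.

Lemma bmeas_sum (I : Type) (r : seq I) (F : I -> measurableTypeR R -> R[i]) :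
  (forall i, bmeas (F i)) -> bmeas (fun t => \sum_(i <- r) F i t).
Proof.
move=> mF; elim: r => [|i r ih].
  by under eq_fun do rewrite big_nil; exact: bmeas_cst.
by under eq_fun do rewrite big_cons; exact: bmeasD.
Qed.

Lemma CintD F G : bmeas F -> bmeas G ->
  Cint (fun t => F t + G t) = Cint F + Cint G.
Proof.
move=> /bmeas_int[Fr Fi] /bmeas_int[Gr Gi]; apply: cplxP.
- rewrite cReD !cRe_Cint.
  by under eq_Rintegral do rewrite cReD; exact: RintegralD.
- rewrite cImD !cIm_Cint.
  by under eq_Rintegral do rewrite cImD; exact: RintegralD.
Qed.

Lemma CintZ (c : R[i]) F : bmeas F -> Cint (fun t => c * F t) = c * Cint F.
Proof.
move=> /bmeas_int[Fr Fi].
have Z (a : R) f : nu.-integrable setT (EFin \o f) ->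
    nu.-integrable setT (EFin \o (fun t => a * f t)).
  by move=> fi; exact: (integrableZl measurableT a fi).
apply: cplxP.
- rewrite cReM !(cRe_Cint, cIm_Cint); under eq_Rintegral do rewrite cReM.
  by rewrite RintegralB ?RintegralZl//; exact: Z.
- rewrite cImM !(cRe_Cint, cIm_Cint); under eq_Rintegral do rewrite cImM.
  by rewrite RintegralD ?RintegralZl//; exact: Z.
Qed.

Lemma Cint_sum (I : Type) (r : seq I) (F : I -> measurableTypeR R -> R[i]) :
  (forall i, bmeas (F i)) ->
  Cint (fun t => \sum_(i <- r) F i t) = \sum_(i <- r) Cint (F i).
Proof.
move=> mF; elim: r => [|i r ih].
  rewrite big_nil; apply: cplxP; rewrite /= /Rintegral;
    by rewrite integral0_eq// => t _; rewrite big_nil.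
rewrite big_cons -ih -CintD//; last exact: bmeas_sum.
by congr Cint; apply/funext => t; rewrite big_cons.
Qed.

Lemma Cint_bound F (C : R) : bmeas F -> (forall t, normc (F t) <= C) ->
  normc (Cint F) <= 2 * C.
Proof.
move=> [mr mi _] FC; apply: (le_trans (normc_le_ReIm _)).
rewrite mulr_natl mulr2n; apply: lerD; apply: Rintegral_bound => // t.
- exact: le_trans (cRe_le_normc _) (FC t).
- exact: le_trans (cIm_le_normc _) (FC t).
Qed.

Lemma bmeas_resolvent (z : R[i]) : 0 < cIm z -> bmeas (fun t => (z - (t%:C)%C)^-1).
Proof.
move=> z0.
have den t : cRe (z - (t%:C)%C) ^+ 2 + cIm (z - (t%:C)%C) ^+ 2
    = (cRe z - t) ^+ 2 + cIm z ^+ 2 by rewrite !cplxE subr0.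
have dpos t : 0 < (cRe z - t) ^+ 2 + cIm z ^+ 2.
  by rewrite ltr_wpDl ?sqr_ge0// exprn_gt0.
have mden : measurable_fun [set: measurableTypeR R]
    (fun t : measurableTypeR R => ((cRe z - t) ^+ 2 + cIm z ^+ 2)^-1).
  apply: (continuous_measurable_fun (f := fun t : R => _)) => t.
  apply: cvgV; first by rewrite gt_eqF.
  apply: cvgD; last exact: cvg_cst.
  by apply: cvgM; (apply: cvgB; [exact: cvg_cst|exact: cvg_id]).
split.
- under eq_fun do rewrite cReV den !cplxE.
  by apply: measurable_funM => //; exact: measurable_funB.
- under eq_fun do rewrite cImV den !cplxE.
  by apply: measurable_funM.
- exists (cIm z)^-1 => t; rewrite normcV lef_pV2 ?posrE ?normc_gt0//.
    apply: le_trans (cIm_le_normc _); rewrite !cplxE subr0; exact: ler_norm.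
  by apply: cIm_neq0; rewrite !cplxE subr0.
Qed.

Lemma geometric_resolvent (a b : R[i]) (N : nat) : a != 0 -> b != 0 ->
  b^-1 - \sum_(n < N) (-1) ^+ n * a^-1 ^+ n.+1 * (b - a) ^+ n
    = (a - b) ^+ N * a^-1 ^+ N * b^-1.
Proof.
move=> a0 b0; elim: N => [|N ih]; first by rewrite big_ord0 subr0 !expr0 !mul1r.
rewrite big_ord_recr /= opprD addrA ih -[b - a]opprB [(- (a - b)) ^+ _]exprNn.
have s : (-1 : R[i]) ^+ N * (-1) ^+ N = 1 by rewrite -exprD addnn -signr_odd odd_double expr0.
set u := (-1) ^+ N; rewrite -/u in s.
have -> : u * a^-1 ^+ N.+1 * (u * (a - b) ^+ N) = (u * u) * (a^-1 ^+ N.+1 * (a - b) ^+ N).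
  by ring.
by rewrite s !exprS; field; rewrite a0 b0.
Qed.

(** The geometric series of the resolvent at z0 = w s0 converges uniformly in t,
    with ratio |w s - z0| / Im z0; it is integrated term by term. *)
Lemma expansible_cauchy (w : R -> R[i]) (s0 h M : R) :
  0 < cIm (w s0) -> 0 < h ->
  (forall s, `|s - s0| < h -> normc (w s - w s0) <= M * `|s - s0|) ->
  expansible w (fun s => cauchy_transform nu (w s)) s0.
Proof.
move=> y0 h0 wM; set z0 := w s0; set y := cIm z0.
have yM : 0 < y / (2 * (`|M| + 1)) by rewrite divr_gt0// mulr_gt0// ltr_wpDl.
exists (fun n => (-1) ^+ n * Cint (fun t => (z0 - (t%:C)%C)^-1 ^+ n.+1)).
exists (4 / y), (`|M| / y), (Num.min h (y / (2 * (`|M| + 1)))); split.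
- by rewrite lt_min h0.
- by rewrite divr_ge0// ltW.
- by rewrite divr_ge0// ltW.
move=> s N; rewrite lt_min => /andP[sh sy].
have wMs : normc (w s - z0) <= `|M| * `|s - s0|.
  by apply: (le_trans (wM s sh)); rewrite ler_wpM2r// ler_norm.
have wy : normc (w s - z0) <= y / 2.
  apply: (le_trans wMs); move: sy; rewrite ltr_pdivlMr; last by rewrite mulr_gt0// ltr_wpDl.
  have : 0 <= `|M| by []; have : 0 <= `|s - s0| by []; nra.
have yw : y / 2 <= cIm (w s).
  have := le_trans (cIm_le_normc _) wy; rewrite !cplxE -/y ler_norml => /andP[]; lra.
have ws0 : 0 < cIm (w s) by apply: lt_le_trans yw; rewrite divr_gt0.
have im t (z : R[i]) : cIm (z - (t%:C)%C) = cIm z by rewrite !cplxE subr0.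
pose rem t := (z0 - w s) ^+ N * ((z0 - (t%:C)%C)^-1 ^+ N * (w s - (t%:C)%C)^-1).
have b0 := bmeas_resolvent y0; have bs := bmeas_resolvent ws0.
have brem : bmeas rem.
  by apply: bmeasM; [exact: bmeas_cst|apply: bmeasM => //; exact: bmeasX].
have -> : cauchy_transform nu (w s) - \sum_(n < N)
    (-1) ^+ n * Cint (fun t => (z0 - (t%:C)%C)^-1 ^+ n.+1) * (w s - z0) ^+ n
  = Cint rem.
  have bt (n : 'I_N) : bmeas (fun t => ((-1) ^+ n * (w s - z0) ^+ n) *
      (z0 - (t%:C)%C)^-1 ^+ n.+1).
    by apply: bmeasM; [exact: bmeas_cst|exact: bmeasX].
  apply/eqP; rewrite subr_eq; apply/eqP.
  have -> : \sum_(n < N)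
      (-1) ^+ n * Cint (fun t => (z0 - (t%:C)%C)^-1 ^+ n.+1) * (w s - z0) ^+ n =
    Cint (fun t => \sum_(n < N) ((-1) ^+ n * (w s - z0) ^+ n) *
      (z0 - (t%:C)%C)^-1 ^+ n.+1).
    rewrite Cint_sum//; apply: eq_bigr => n _; rewrite CintZ; last exact: bmeasX.
    by ring.
  rewrite -CintD//; last exact: bmeas_sum.
  congr Cint; apply/funext => t.
  have := @geometric_resolvent (z0 - (t%:C)%C) (w s - (t%:C)%C) N.
  have -> : w s - (t%:C)%C - (z0 - (t%:C)%C) = w s - z0 by ring.
  have -> : z0 - (t%:C)%C - (w s - (t%:C)%C) = z0 - w s by ring.
  move=> /(_ (cIm_neq0 _) (cIm_neq0 _)); rewrite !im => /(_ y0 ws0) geo.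
  rewrite /rem mulrA -geo [X in _ - X + _](eq_bigr (fun n : 'I_N =>
    ((-1) ^+ n * (w s - z0) ^+ n) * (z0 - (t%:C)%C)^-1 ^+ n.+1)) ?subrK//.
  by move=> n _; ring.
have -> : 4 / y * (`|M| / y * `|s - s0|) ^+ N
  = 2 * ((`|M| * `|s - s0| / y) ^+ N * (y / 2)^-1).
  rewrite invf_div -[_ / y * `|_|]mulrAC.
  by move: (_ ^+ N) => q; field; rewrite gt_eqF.
apply: Cint_bound => // t; rewrite /rem !normcM !normcX mulrA -exprMn.
have inv_le (z : R[i]) (c : R) : 0 < c -> c <= cIm z -> normc (z - (t%:C)%C)^-1 <= c^-1.
  move=> c0 cz; rewrite normcV lef_pV2 ?posrE ?normc_gt0//.
    by apply: le_trans (cIm_le_normc _); rewrite im (le_trans cz)// ler_norm.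
  by apply: cIm_neq0; rewrite im (lt_le_trans c0).
apply: ler_pM; rewrite ?exprn_ge0 ?mulr_ge0 ?normc_ge0//; last first.
  by apply: inv_le; rewrite // divr_gt0.
rewrite lerXn2r ?nnegrE ?mulr_ge0 ?normc_ge0 ?invr_ge0 ?(ltW y0)//.
apply: ler_pM; rewrite ?normc_ge0//; last exact: inv_le.
by rewrite -normcN opprB.
Qed.

End cauchy_transform.

(** * The map K in polar coordinates *)

Section polar.
Context {R : realType}.
Variables (alpha kap : R).
Hypotheses (alpha1 : 1 < alpha) (alpha2 : alpha < 2).
Hypotheses (kap0 : 0 <= kap) (kap1 : kap <= (2 - alpha) * pi).
Implicit Types (u th s : R).

Definition zc u th : R[i] := ((expR u)%:C)%C * expi th.
(** The Voiculescu transform at zc u th (see stable_voiculescu_zc), where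
    kap = (2 - alpha) rho pi. *)
Definition yc u th : R[i] :=
  ((expR (- (alpha - 1) * u))%:C)%C * expi (- (kap + (alpha - 1) * th)).
Definition Kc u th := zc u th + yc u th.
(** zc times the derivative of Kc with respect to zc, as yc is a power of zc. *)
Definition qc u th := zc u th - ((alpha - 1)%:C)%C * yc u th.
Definition sa th := sin (kap + (alpha - 1) * th).
Definition ca th := cos (kap + (alpha - 1) * th).

Lemma Re_zc u th : cRe (zc u th) = expR u * cos th.
Proof. by rewrite /zc !cplxE mul0r subr0. Qed.
Lemma Im_zc u th : cIm (zc u th) = expR u * sin th.
Proof. by rewrite /zc !cplxE mul0r addr0. Qed.
Lemma Re_yc u th : cRe (yc u th) = expR (- (alpha - 1) * u) * ca th.
Proof. by rewrite /yc !cplxE mul0r subr0 cosN. Qed.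
Lemma Im_yc u th : cIm (yc u th) = - (expR (- (alpha - 1) * u) * sa th).
Proof. by rewrite /yc !cplxE mul0r addr0 sinN mulrN. Qed.
Lemma Re_Kc u th : cRe (Kc u th) = expR u * cos th + expR (- (alpha - 1) * u) * ca th.
Proof. by rewrite /Kc cReD Re_zc Re_yc. Qed.
Lemma Im_Kc u th : cIm (Kc u th) = expR u * sin th - expR (- (alpha - 1) * u) * sa th.
Proof. by rewrite /Kc cImD Im_zc Im_yc. Qed.
Lemma Re_qc u th : cRe (qc u th)
  = expR u * cos th - (alpha - 1) * (expR (- (alpha - 1) * u) * ca th).
Proof. by rewrite /qc cReD cReN Re_zc cReM Re_yc !cplxE mul0r subr0. Qed.
Lemma Im_qc u th : cIm (qc u th)
  = expR u * sin th + (alpha - 1) * (expR (- (alpha - 1) * u) * sa th).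
Proof. by rewrite /qc cImD cImN Im_zc cImM Im_yc !cplxE mul0r addr0 mulrN opprK. Qed.

Lemma normc_zc u th : normc (zc u th) = expR u.
Proof. by rewrite /zc normcM normc_expi mulr1 normcC gtr0_norm ?expR_gt0. Qed.
Lemma normc_yc u th : normc (yc u th) = expR (- (alpha - 1) * u).
Proof. by rewrite /yc normcM normc_expi mulr1 normcC gtr0_norm ?expR_gt0. Qed.
Lemma zc_neq0 u th : zc u th != 0.
Proof. by rewrite -normc_gt0 normc_zc expR_gt0. Qed.

(** The angle kap + (alpha - 1) th is a convex combination of rho pi and th. *)
Lemma sa_ge0 th : 0 <= th -> th <= pi -> 0 <= sa th.
Proof.
move=> th0 thpi; apply: sin_ge0_pi; apply/andP; split.
  by rewrite addr_ge0// mulr_ge0// subr_ge0 ltW.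
have : (alpha - 1) * th <= (alpha - 1) * pi by rewrite ler_wpM2l// subr_ge0 ltW.
by move: kap1; lra.
Qed.

(** Both terms of Im qc are nonnegative; so the derivative of Kc has no zero in
    the upper half-plane. *)
Lemma Im_qc_ge u th : 0 < th -> th < pi -> expR u * sin th <= cIm (qc u th).
Proof.
move=> th0 thpi; rewrite Im_qc lerDl !mulr_ge0 ?expR_ge0 ?subr_ge0 ?(ltW alpha1)//.
by apply: sa_ge0; exact: ltW.
Qed.

Lemma Im_qc_gt0 u th : 0 < th -> th < pi -> 0 < cIm (qc u th).
Proof.
move=> th0 thpi; apply: (lt_le_trans _ (Im_qc_ge u th0 thpi)).
by rewrite mulr_gt0 ?expR_gt0 ?sin_gt0_pi// th0.
Qed.

(** Along a curve, d(log zc) is du + i dth, and d(log yc) is - (alpha - 1) times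
    as much; hence dKc = qc * (du + i dth) below. *)
Lemma cderive_zc (u th : R -> R) (s du dth : R) :
  is_derive s 1 u du -> is_derive s 1 th dth ->
  cderive (fun t => zc (u t) (th t)) s (zc (u s) (th s) * (du +i* dth)%C).
Proof.
move=> hu hth; split.
- under eq_fun do rewrite Re_zc.
  have h := drvM (drv_comp (is_derive_expR (u s)) hu) (drv_comp (is_derive_cos (th s)) hth).
  by apply: (drv_eq h); rewrite cReM Re_zc Im_zc /=; ring.
- under eq_fun do rewrite Im_zc.
  have h := drvM (drv_comp (is_derive_expR (u s)) hu) (drv_comp (is_derive_sin (th s)) hth).
  by apply: (drv_eq h); rewrite cImM Re_zc Im_zc /=; ring.
Qed.

Lemma cRe_NCM (b c d : R) (y : R[i]) :
  cRe (- (b%:C)%C * y * (c +i* d)%C) = - b * (cRe y * c - cIm y * d).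
Proof. by rewrite !cplxE /=; ring. Qed.

Lemma cIm_NCM (b c d : R) (y : R[i]) :
  cIm (- (b%:C)%C * y * (c +i* d)%C) = - b * (cRe y * d + cIm y * c).
Proof. by rewrite !cplxE /=; ring. Qed.

Lemma cderive_yc (u th : R -> R) (s du dth : R) :
  is_derive s 1 u du -> is_derive s 1 th dth ->
  cderive (fun t => yc (u t) (th t)) s
    (- ((alpha - 1)%:C)%C * yc (u s) (th s) * (du +i* dth)%C).
Proof.
move=> hu hth.
have hu' := drv_comp (g := fun t => - (alpha - 1) * u t)
  (is_derive_expR (- (alpha - 1) * u s)) (drvM (drvc (- (alpha - 1)) s) hu).
have ht := drvD (drvc kap s) (drvM (drvc (alpha - 1) s) hth).
split.
- under eq_fun do rewrite Re_yc.
  apply: (drv_eq (drvM hu' (drv_comp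
    (g := fun t => kap + (alpha - 1) * th t) (is_derive_cos (kap + (alpha - 1) * th s)) ht))).
  by rewrite cRe_NCM Re_yc Im_yc /ca /sa; ring.
- under eq_fun do rewrite Im_yc -sub0r.
  apply: (drv_eq (drvB (drvc 0 s) (drvM hu' (drv_comp
    (g := fun t => kap + (alpha - 1) * th t) (is_derive_sin (kap + (alpha - 1) * th s)) ht)))).
  by rewrite cIm_NCM Re_yc Im_yc /ca /sa; ring.
Qed.

Lemma cderive_Kc (u th : R -> R) (s du dth : R) :
  is_derive s 1 u du -> is_derive s 1 th dth ->
  cderive (fun t => Kc (u t) (th t)) s (qc (u s) (th s) * (du +i* dth)%C).
Proof.
move=> hu hth.
apply: (cderive_eq (cderiveD (cderive_zc hu hth) (cderive_yc hu hth))).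
by rewrite /qc; ring.
Qed.

(** Here p = 1 / zc and D = zc / qc, which satisfy the differential equations of
    cderive_jet. Near s0 they stay bounded, D because of Im_qc_ge. *)
Lemma expansible_polar (u th du dth : R -> R) (s0 h W : R) : 0 < h ->
  (forall s, `|s - s0| < h ->
    [/\ is_derive s 1 u (du s), is_derive s 1 th (dth s), 0 < th s, th s < pi &
        normc (qc (u s) (th s) * (du s +i* dth s)%C) <= W]) ->
  expansible (fun s => Kc (u s) (th s)) (fun s => (zc (u s) (th s))^-1) s0.
Proof.
move=> h0 H.
have [hu0 hth0 th0 thpi _] : [/\ is_derive s0 1 u (du s0),
    is_derive s0 1 th (dth s0), 0 < th s0, th s0 < pi & true].
  by have [|? ? ? ?] := H s0; rewrite ?subrr ?normr0.
have sin0 : 0 < sin (th s0) by rewrite sin_gt0_pi// th0.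
have cu : {for s0, continuous u} := drv_continuous hu0.
have csin : {for s0, continuous (fun s => sin (th s))}.
  exact: drv_continuous (drv_comp (is_derive_sin (th s0)) hth0).
have : \forall s \near s0, `|s0 - s| < h /\ (`|u s0 - u s| < 1 /\
    `|sin (th s0) - sin (th s)| < sin (th s0) / 2).
  near=> s; split; [|split]; near: s.
  - have /cvgr_dist_lt : s @[s --> s0] --> s0 by exact: cvg_id.
    by apply.
  - by move/cvgr_dist_lt : cu; apply.
  - by move/cvgr_dist_lt : csin; apply; rewrite divr_gt0.
move=> /nbhs_ballP[d /= d0 dP].
pose B := Num.max 1 (Num.max (expR (1 - u s0)) (2 / sin (th s0))).
have B1 : 1 <= B by rewrite le_max lexx.
apply: (@expansible_curve _ (alpha - 1) _ _ _ (fun s => zc (u s) (th s) / qc (u s) (th s))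
  (fun s => qc (u s) (th s) * (du s +i* dth s)%C) _ s0 d B W) => //.
- by rewrite subr_ge0 ltW.
- by rewrite lerBlDr; apply: ltW; apply: (lt_le_trans alpha2); rewrite -natr1.
move=> s sd; have [sh [us ss]] : `|s0 - s| < h /\ (`|u s0 - u s| < 1 /\
    `|sin (th s0) - sin (th s)| < sin (th s0) / 2).
  by apply: dP; rewrite /ball /= distrC.
have [hu hth ths thps vW] : [/\ is_derive s 1 u (du s), is_derive s 1 th (dth s),
    0 < th s, th s < pi & normc (qc (u s) (th s) * (du s +i* dth s)%C) <= W].
  by apply: H; rewrite distrC.
have z0 := zc_neq0 (u s) (th s).
have q0 : qc (u s) (th s) != 0 by apply: cIm_neq0; exact: Im_qc_gt0.
have dz := cderive_zc hu hth.
have dq := cderiveD dz (cderiveN (cderive_Z ((alpha - 1)%:C)%C (cderive_yc hu hth))).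
have b1 : ((alpha - 1 + 1)%:C)%C = ((alpha - 1)%:C)%C + 1 :> R[i].
  by rewrite rmorphD rmorph1.
have yE : ((alpha - 1)%:C)%C * yc (u s) (th s) = zc (u s) (th s) - qc (u s) (th s).
  by rewrite /qc; ring.
split.
- exact: cderive_Kc.
- apply: (cderive_eq (cderiveV (F := fun t => zc (u t) (th t)) z0 dz)).
  by move: z0 q0; set z := zc _ _; set q := qc _ _; set m := (_ +i* _)%C => z0 q0;
    field; rewrite z0 q0.
- apply: (cderive_eq (cderiveM dz (cderiveV (F := fun t => qc (u t) (th t)) q0 dq))).
  have -> : ((alpha - 1)%:C)%C * (- ((alpha - 1)%:C)%C * yc (u s) (th s) * (du s +i* dth s)%C)
    = - ((alpha - 1)%:C)%C * (zc (u s) (th s) - qc (u s) (th s)) * (du s +i* dth s)%C.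
    by rewrite -yE; ring.
  rewrite b1; move: z0 q0; set z := zc _ _; set q := qc _ _; set m := (_ +i* _)%C.
  by set b := ((alpha - 1)%:C)%C => z0 q0; field; rewrite z0 q0.
- split => //.
  + rewrite normcV normc_zc -expRN !le_max; apply/orP; right; apply/orP; left.
    rewrite ler_expR; move: us; rewrite ltr_distl => /andP[]; lra.
  + rewrite normcM normcV normc_zc !le_max; apply/orP; right; apply/orP; right.
    have ssin : sin (th s0) / 2 <= sin (th s).
      by move: ss; rewrite ltr_distl => /andP[]; lra.
    have sq : expR (u s) * (sin (th s0) / 2) <= normc (qc (u s) (th s)).
      apply: le_trans (cIm_le_normc _); apply: le_trans (ler_norm _).
      apply: (le_trans _ (Im_qc_ge _ ths thps)).
      by rewrite ler_wpM2l ?expR_ge0.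
    rewrite ler_pdivrMr ?normc_gt0//.
    have : 2 / sin (th s0) * (expR (u s) * (sin (th s0) / 2)) <=
        2 / sin (th s0) * normc (qc (u s) (th s)).
      by rewrite ler_wpM2l// divr_ge0// ltW.
    apply: le_trans; rewrite le_eqVlt; apply/orP; left; apply/eqP; field.
    by rewrite gt_eqF.
Unshelve. all: by end_near.
Qed.

End polar.

(** * Analytic continuation along a ray *)

Section radial.
Context {R : realType}.
Variables (alpha kap : R).
Hypotheses (alpha1 : 1 < alpha) (alpha2 : alpha < 2).
Hypotheses (kap0 : 0 <= kap) (kap1 : kap <= (2 - alpha) * pi).
Variable nu : probability (measurableTypeR R) R.

Local Notation zc := (@zc R).
Local Notation yc := (yc alpha kap).
Local Notation Kc := (Kc alpha kap).
Local Notation qc := (qc alpha kap).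
Local Notation sa := (sa alpha kap).

(** What the Voiculescu transform says about the Cauchy transform, on each ray. *)
Definition inverse_at_infinity := forall th : R, 0 < th -> th < pi ->
  exists U : R, forall u, U < u -> cauchy_transform nu (Kc u th) = (zc u th)^-1.

(** On a ray, Im Kc is the difference of an increasing exponential and a
    decreasing one; the slope of the first bounds the growth from below. *)
Lemma Im_Kc_incr (th u v : R) : 0 < th -> th < pi -> u <= v ->
  expR u * sin th * (v - u) <= cIm (Kc v th) - cIm (Kc u th).
Proof.
move=> th0 thpi uv; rewrite !Im_Kc.
have s0 : 0 <= sa th by apply: sa_ge0 => //; exact: ltW.
have sin0 : 0 <= sin th by rewrite ltW// sin_gt0_pi// th0.
have e1 : expR (- (alpha - 1) * v) <= expR (- (alpha - 1) * u).
  by rewrite ler_expR !mulNr lerN2 ler_wpM2l// subr_ge0 ltW.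
have e2 : expR u * (v - u) <= expR v - expR u.
  have := expR_ge1Dx (v - u); rewrite -(ler_pM2l (expR_gt0 u)) -expRD.
  by rewrite [u + _]addrC subrK; lra.
move: (ler_wpM2r sin0 e2) (ler_wpM2r s0 e1); lra.
Qed.

Lemma normc_qc u th : normc (qc u th) <= expR u + expR (- (alpha - 1) * u).
Proof.
rewrite /qc; apply: (le_trans (normcB _ _)); rewrite normcM normc_zc normc_yc normcC.
rewrite lerD2l -[leRHS]mul1r ler_wpM2r ?expR_ge0// ger0_norm ?subr_ge0 ?ltW//.
by rewrite ltrBlDr.
Qed.

Hypothesis nuE : inverse_at_infinity.

(** Analytic continuation along a ray: the set of u above which the Cauchy
    transform of Kc is the inverse of zc can only stop where Kc leaves the upper
    half-plane. *)
Lemma inverse_on_ray (u1 th : R) : 0 < th -> th < pi -> 0 < cIm (Kc u1 th) ->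
  forall u, u1 <= u -> cauchy_transform nu (Kc u th) = (zc u th)^-1.
Proof.
move=> th0 thpi K1.
pose E := [set u | u1 <= u /\ forall v, u <= v ->
  cauchy_transform nu (Kc v th) = (zc v th)^-1].
have [U HU] := nuE th0 thpi.
have E0 : E !=set0.
  exists (Num.max u1 (U + 1)); split; first by rewrite le_max lexx.
  by move=> v; rewrite ge_max => /andP[_ Uv]; apply: HU; lra.
have lbE : has_lbound E by exists u1 => u [].
have infE : has_inf E by split.
(* the identity holds above i; both sides have an expansion at i, so it holds
   on a neighbourhood of i *)
set i := inf E.
have u1i : u1 <= i by apply: lb_le_inf => // u [].
have above v : i < v -> cauchy_transform nu (Kc v th) = (zc v th)^-1.
  by move=> /(inf_lt E0) [u [_ uE] /ltW uv]; exact: uE.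
have sin0 : 0 < sin th by rewrite sin_gt0_pi// th0.
have Ki : 0 < cIm (Kc i th).
  apply: (lt_le_trans K1); rewrite -subr_ge0.
  apply: le_trans (Im_Kc_incr th0 thpi u1i).
  by rewrite !mulr_ge0 ?expR_ge0 ?subr_ge0// ltW.
pose W := expR (i + 1) + expR (- (alpha - 1) * (i - 1)).
have qW s : `|s - i| < 1 -> normc (qc s th) <= W.
  rewrite ltr_distl => /andP[s1 s2]; apply: (le_trans (normc_qc _ _)).
  apply: lerD; rewrite ler_expR; first exact: ltW.
  by rewrite !mulNr lerN2 ler_wpM2l ?subr_ge0// ltW.
have dK s : cderive (fun s => Kc s th) s (qc s th).
  apply: (cderive_eq (cderive_Kc alpha kap (is_derive_id s 1) (drvc th s))).
  by rewrite complexr0 rmorph1 mulr1.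
have ex1 : expansible (fun s => Kc s th) (fun s => (zc s th)^-1) i.
  apply: (@expansible_polar _ _ _ alpha1 alpha2 kap0 kap1 id (fun=> th)
    (fun=> 1) (fun=> 0) i 1 W) => // s s1; split => //.
  - exact: is_derive_id.
  - exact: drvc.
  - by rewrite complexr0 rmorph1 mulr1 qW.
have ex2 : expansible (fun s => Kc s th) (fun s => cauchy_transform nu (Kc s th)) i.
  apply: (@expansible_cauchy _ nu (fun s => Kc s th) i 1 (2 * W)) => // s s1.
  apply: (@cderive_mvt _ (fun s => Kc s th) (fun s => qc s th)) => t ts //.
  exact: qW (le_lt_trans ts s1).
have [|s /andP[is_ _]|s /andP[is_ _]|r r0 Hr] := @expansible_unique _ _ _ _ i 1
  (expR i * sin th) ex2 ex1 ltr01.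
- by rewrite mulr_gt0 ?expR_gt0.
- rewrite gtr0_norm ?subr_gt0//.
  apply: (le_trans (Im_Kc_incr th0 thpi (ltW is_))).
  by apply: le_trans (cIm_le_normc _); rewrite !cplxE ler_norm.
- exact: above.
move=> u u1u; have [iu|ui] := ltP i u; first exact: above.
have iE : u1 = i.
  apply/eqP; rewrite eq_le u1i /= leNgt; apply/negP => ltu1i.
  pose m := Num.max u1 (i - r / 2).
  have mi : m < i by rewrite gt_max ltu1i; lra.
  suff /(ge_inf lbE) : E m by rewrite -/i leNgt mi.
  split; first by rewrite le_max lexx.
  move=> v mv; have [|vi] := ltP i v; first exact: above.
  apply: Hr; rewrite ler0_norm ?subr_le0//.
  by move: mv; rewrite ge_max => /andP[_]; lra.
have -> : u = i by apply/eqP; rewrite eq_le ui -iE u1u.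
by apply: Hr; rewrite subrr normr0.
Qed.

End radial.

Section hypothesis.
Context {R : realType}.
Variables (alpha rho : R) (nu : probability (measurableTypeR R) R).

Lemma Carg_zc (u th : R) : 0 < th -> th < pi -> Carg (zc u th) = th.
Proof.
move=> th0 thpi; rewrite /Carg.
have -> : 0 <= cIm (zc u th).
  by rewrite Im_zc mulr_ge0 ?expR_ge0// sin_ge0_pi// !ltW.
rewrite cmodE normc_zc Re_zc mulrAC divff ?gt_eqF ?expR_gt0// mul1r cosK//.
by rewrite in_itv /= !ltW.
Qed.

Lemma stable_voiculescu_zc (u th : R) : 0 < th -> th < pi ->
  stable_voiculescu alpha rho (zc u th) = yc alpha ((2 - alpha) * rho * pi) u th.
Proof.
move=> th0 thpi; rewrite /stable_voiculescu /cpow Carg_zc// cmodE normc_zc /yc.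
rewrite mulrCA -expiD /powR gt_eqF ?expR_gt0// expRK.
by congr ((expR _)%:C%C * expi _); ring.
Qed.

(** The ray of argument th lies in the cones of aperture larger than |cot th|. *)
Lemma free_stable_inverse : is_free_stable alpha rho nu ->
  inverse_at_infinity alpha ((2 - alpha) * rho * pi) nu.
Proof.
move=> H th th0 thpi.
have sin0 : 0 < sin th by rewrite sin_gt0_pi// th0.
have eta0 : 0 < (`|cos th| + 1) / sin th by rewrite divr_gt0// ltr_wpDl.
have [M M0 [Finv [_ _ FK _] phiE]] := H _ eta0.
exists (ln (M / sin th)) => u Mu.
have Msin : 0 < M / sin th by rewrite divr_gt0.
have cz : cone ((`|cos th| + 1) / sin th) M (zc u th).
  split; first by rewrite Im_zc -ltr_pdivrMr// -[ltLHS]lnK ?posrE// ltr_expR.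
  rewrite Re_zc Im_zc normrM gtr0_norm ?expR_gt0// mulrCA divfK ?gt_eqF//.
  by rewrite ltr_pM2l ?expR_gt0// ltrDl.
have := FK _ cz; rewrite /F_transform => /(congr1 (fun z => z^-1)); rewrite invrK => <-.
congr cauchy_transform; rewrite /Kc -stable_voiculescu_zc// (phiE _ cz).
by rewrite addrC subrK.
Qed.

End hypothesis.

(** * Bounded convergence and probabilities of intervals *)

Section bounded_convergence.
Context {R : realType}.
Variable nu : probability (measurableTypeR R) R.
Implicit Types (f g : measurableTypeR R -> R) (A : set (measurableTypeR R)).

Lemma bounded_cvg (f_ : nat -> measurableTypeR R -> R) f (C : R) :
  (forall n, measurable_fun setT (f_ n)) -> (forall n t, `|f_ n t| <= C) ->
  (forall t, f_ n t @[n --> \oo] --> f t) ->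
  \int[nu]_t f_ n t @[n --> \oo] --> \int[nu]_t f t.
Proof.
move=> mf fC ff.
have mlim : measurable_fun setT f.
  exact: (measurable_fun_cvg mf (fun t _ => ff t)).
have fC' t : `|f t| <= C.
  have /cvgr_to_le : `|f_ n t| @[n --> \oo] --> `|f t| by apply: cvg_norm; exact: ff.
  by apply; apply: nearW.
have fi := bounded_integrable nu mlim fC'.
apply: fine_cvg; rewrite /Rintegral fineK; last exact: integrable_fin_num.
apply: (dominated_cvg measurableT (g := EFin \o cst C)) => //.
- by move=> n; exact/measurable_EFinP.
- by move=> t _; apply: cvg_EFin; [exact: nearW|exact: ff].
- exact: (finite_measure_integrable_cst nu C measurableT).
- by move=> n t _; rewrite lee_fin.
Qed.

(** The probability of A as a real number. *)
Definition pr A : R := fine (nu A).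

Lemma prE A : measurable A -> nu A = (pr A)%:E.
Proof. by move=> mA; rewrite /pr fineK// fin_num_measure. Qed.

Lemma Rintegral_indic_pr A (c : R) : measurable A ->
  \int[nu]_t (c * \1_A t) = c * pr A.
Proof.
move=> mA; rewrite RintegralZl//; last exact: integrable_indic.
by rewrite /Rintegral integral_indic// setIT.
Qed.

End bounded_convergence.

Section survival_of_probability.
Context {R : realType}.
Variable nu : probability (measurableTypeR R) R.
Implicit Types (A B : set (measurableTypeR R)).

Lemma probability_lty A : measurable A -> (nu A < +oo)%E.
Proof. by move=> mA; rewrite prE// ltry. Qed.

Lemma pr_ge0 A : measurable A -> 0 <= pr nu A.
Proof. by move=> mA; rewrite -lee_fin -prE. Qed.

Lemma pr_le A B : measurable A -> measurable B -> A `<=` B -> pr nu A <= pr nu B.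
Proof. by move=> mA mB AB; rewrite -lee_fin -!prE// le_measure// inE. Qed.

Lemma pr_ocitv (a c : R) : a <= c ->
  pr nu `]a, c]%classic = pr nu `]a, +oo[%classic - pr nu `]c, +oo[%classic.
Proof.
move=> ac; apply/eqP; rewrite eq_sym subr_eq; apply/eqP/EFin_inj.
rewrite EFinD -!prE// -measureU//.
  by congr (nu _); rewrite -itv_bndbnd_setU// bnd_simp.
by apply/seteqP; split => x //= []; rewrite !in_itv /= andbT => /andP[_ xc]; rewrite ltNge xc.
Qed.

Lemma pr_setC A : measurable A -> pr nu (~` A) = 1 - pr nu A.
Proof.
move=> mA; apply: EFin_inj; rewrite EFinB -!prE//; last exact: measurableC.
exact: probability_setC.
Qed.

End survival_of_probability.

(** * The argument integral *)

Section argument.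
Context {R : realType}.
Variables (alpha kap : R).
Hypotheses (alpha1 : 1 < alpha) (alpha2 : alpha < 2).
Hypotheses (kap0 : 0 <= kap) (kap1 : kap <= (2 - alpha) * pi).
Variable nu : probability (measurableTypeR R) R.
Hypothesis nuE : inverse_at_infinity alpha kap nu.

Local Notation zc := (@zc R).
Local Notation yc := (yc alpha kap).
Local Notation Kc := (Kc alpha kap).
Local Notation qc := (qc alpha kap).
Local Notation sa := (sa alpha kap).
Local Notation ca := (ca alpha kap).

Lemma cRe_subC (w : R[i]) (t : R) : cRe (w - (t%:C)%C) = cRe w - t.
Proof. by rewrite cReD cReN. Qed.

Lemma cIm_subC (w : R[i]) (t : R) : cIm (w - (t%:C)%C) = cIm w.
Proof. by rewrite cImD cImN subr0. Qed.

Lemma sa_gt0 (th : R) : 0 < th -> th < pi -> 0 < sa th.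
Proof.
move=> th0 thpi; apply: sin_gt0_pi; apply/andP; split.
  by rewrite ltr_wpDl// mulr_gt0// subr_gt0.
have : (alpha - 1) * th < (alpha - 1) * pi by rewrite ltr_pM2l// subr_gt0.
by move: kap1; lra.
Qed.

(** The cotangent of the argument of w - t, so that pi / 2 - atan (cotan w t) is
    this argument when Im w > 0. *)
Definition cotan (w : R[i]) (t : R) : R := (cRe w - t) / cIm w.

Lemma measurable_atan_cotan (w : R[i]) :
  measurable_fun setT (fun t : measurableTypeR R => atan (cotan w t)).
Proof.
apply: (continuous_measurable_fun (f := fun t : R => _)) => t.
apply: (@continuous_comp _ _ _ (cotan w) (@atan R)); last exact: continuous_atan.
by apply: cvgM; [apply: cvgB; [exact: cvg_cst|exact: cvg_id]|exact: cvg_cst].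
Qed.

Lemma atan_bound (x : R) : `|atan x| <= pi / 2.
Proof. by rewrite ler_norml !ltW// ?atan_ltpi2 ?atan_gtNpi2. Qed.

Section ray.
Variable th : R.
Hypotheses (th0 : 0 < th) (thpi : th < pi).

Local Lemma sin_arg_gt0 : 0 < sin th. Proof. by rewrite sin_gt0_pi// th0. Qed.

Lemma cderive_ray (s : R) : cderive (fun s => Kc s th) s (qc s th).
Proof.
apply: (cderive_eq (cderive_Kc alpha kap (is_derive_id s 1) (drvc th s))).
by rewrite complexr0 rmorph1 mulr1.
Qed.

(** The differential of arg (w - t) is the imaginary part of dw / (w - t). *)
Lemma is_derive_atan_cotan (u t : R) : 0 < cIm (Kc u th) ->
  is_derive u 1 (fun u => atan (cotan (Kc u th) t))
    (- cIm (qc u th * (Kc u th - (t%:C)%C)^-1)).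
Proof.
move=> y0; have [dx dy] := cderive_ray u.
have d := drv_comp (g := fun u => cotan (Kc u th) t)
  (is_derive1_atan (cotan (Kc u th) t))
  (drvM (drvB dx (drvc t u)) (drvV (f := fun u => cIm (Kc u th)) (lt0r_neq0 y0) dy)).
apply: (drv_eq d); rewrite /cotan cImM cReV cImV !cRe_subC !cIm_subC.
move: y0; set x := cRe (Kc u th); set y := cIm (Kc u th).
set a := cRe (qc _ _); set b := cIm (qc _ _) => y0.
have n0 : y != 0 by rewrite gt_eqF.
have n1 : (x - t) ^+ 2 + y ^+ 2 != 0 by rewrite gt_eqF// ltr_wpDl ?sqr_ge0// exprn_gt0.
have n2 : 1 + ((x - t) / y) ^+ 2 != 0 by rewrite gt_eqF// ltr_pwDl ?sqr_ge0.
have -> : 1 + ((x - t) / y) ^+ 2 = ((x - t) ^+ 2 + y ^+ 2) / y ^+ 2 by field.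
by field; rewrite n0 n1.
Qed.

Definition arg_int (u : R) : R := \int[nu]_t atan (cotan (Kc u th) t).

Lemma Im_Kc_le (u v : R) : u <= v -> cIm (Kc u th) <= cIm (Kc v th).
Proof.
move=> uv; rewrite -subr_ge0.
apply: le_trans (Im_Kc_incr alpha1 kap0 kap1 th0 thpi uv).
by rewrite !mulr_ge0 ?expR_ge0 ?subr_ge0// ltW// sin_arg_gt0.
Qed.

(** The argument integral is differentiated under the integral sign; the
    derivative involves the Cauchy transform, which is known on the ray. *)
Lemma is_derive_arg_int (u1 u : R) : 0 < cIm (Kc u1 th) -> u1 < u ->
  is_derive u 1 arg_int (- cIm (qc u th / zc u th)).
Proof.
move=> y1 u1u.
pose W := expR (u + 1) + expR (- (alpha - 1) * u1).
have yge v : u1 <= v -> 0 < cIm (Kc v th) by move=> /Im_Kc_le; exact: lt_le_trans.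
have bnd v t : u1 < v < u + 1 ->
    `|- cIm (qc v th * (Kc v th - (t%:C)%C)^-1)| <= W / cIm (Kc u1 th).
  move=> /andP[u1v vu]; rewrite normrN; apply: (le_trans (cIm_le_normc _)).
  rewrite normcM; apply: ler_pM; rewrite ?normc_ge0//.
    apply: (le_trans (normc_qc kap alpha1 alpha2 v th)).
    apply: lerD; rewrite ler_expR; first exact: ltW.
    by rewrite !mulNr lerN2 ler_wpM2l ?subr_ge0// ltW.
  have im : cIm (Kc v th - (t%:C)%C) = cIm (Kc v th) by rewrite cIm_subC.
  rewrite normcV lef_pV2 ?posrE ?normc_gt0//.
    apply: le_trans (cIm_le_normc _); rewrite im; apply: le_trans (ler_norm _).
    exact/Im_Kc_le/ltW.
  by apply: cIm_neq0; rewrite im yge// ltW.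
have inI (v : R) : (`]u1, (u + 1)[%classic : set R) v -> u1 < v < u + 1.
  by move=> /=; rewrite in_itv /=.
have Iu : (`]u1, (u + 1)[%classic : set R) u.
  by rewrite /= in_itv /= u1u ltrDl ltr01.
have dE v t : u1 < v < u + 1 -> is_derive v 1 (fun v => atan (cotan (Kc v th) t))
    (- cIm (qc v th * (Kc v th - (t%:C)%C)^-1)).
  by move=> /andP[u1v _]; apply: is_derive_atan_cotan; rewrite yge// ltW.
pose f (v : R) (t : measurableTypeR R) : R := atan (cotan (Kc v th) t).
have fi (v : R) : (`]u1, (u + 1)[%classic : set R) v ->
    nu.-integrable setT (EFin \o f v).
  move=> _; apply: (@bounded_integrable _ nu _ (pi / 2)).
    exact: measurable_atan_cotan.
  by move=> t; exact: atan_bound.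
have fd (v : R) (t : measurableTypeR R) : (`]u1, (u + 1)[%classic : set R) v ->
    [set: measurableTypeR R] t -> derivable (f ^~ t) v 1.
  by move=> /inI v1 _; have [] := dE _ t v1.
have d1 (v : R) (t : measurableTypeR R) : (`]u1, (u + 1)[%classic : set R) v ->
    partial1of2 f v t = - cIm (qc v th * (Kc v th - (t%:C)%C)^-1).
  by move=> /inI v1; rewrite partial1of2E; have [_ ->] := dE _ t v1.
have W0 : 0 <= W / cIm (Kc u1 th) by rewrite divr_ge0 ?(ltW y1)// /W addr_ge0 ?expR_ge0.
have Gi : nu.-integrable setT (EFin \o (fun=> W / cIm (Kc u1 th))).
  exact: (finite_measure_integrable_cst nu _ measurableT).
have fb (v : R) (t : measurableTypeR R) : (`]u1, (u + 1)[%classic : set R) v ->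
    [set: measurableTypeR R] t -> `|partial1of2 f v t| <= W / cIm (Kc u1 th).
  by move=> Iv _; rewrite d1//; apply: bnd; exact: inI.
have dF := derivable_under_integral measurableT Iu fi fd (fun=> W0) Gi fb.
have F' := differentiation_under_integral measurableT Iu fi fd (fun=> W0) Gi fb.
apply: DeriveDef; first exact: dF.
rewrite -derive1E; apply: etrans; first exact: F'.
have y0 : 0 < cIm (Kc u th) by rewrite yge// ltW.
have -> : qc u th / zc u th = Cint nu (fun t => qc u th * (Kc u th - (t%:C)%C)^-1).
  rewrite CintZ; last exact: bmeas_resolvent.
  by rewrite -(inverse_on_ray alpha1 alpha2 kap0 kap1 nuE th0 thpi y1 (ltW u1u)).
rewrite cIm_Cint -mulN1r -RintegralZl//; last first.
  suff /(bmeas_int nu)[] : bmeas (fun t => qc u th * (Kc u th - (t%:C)%C)^-1) by [].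
  by apply: bmeasM; [exact: bmeas_cst|exact: bmeas_resolvent].
by apply: eq_Rintegral => t _; rewrite d1// mulN1r.
Qed.

End ray.
End argument.

Section survival.
Context {R : realType}.
Variables (alpha kap : R).
Hypotheses (alpha1 : 1 < alpha) (alpha2 : alpha < 2).
Hypotheses (kap0 : 0 <= kap) (kap1 : kap <= (2 - alpha) * pi).
Variable nu : probability (measurableTypeR R) R.
Hypothesis nuE : inverse_at_infinity alpha kap nu.

Local Notation zc := (@zc R).
Local Notation yc := (yc alpha kap).
Local Notation Kc := (Kc alpha kap).
Local Notation qc := (qc alpha kap).
Local Notation sa := (sa alpha kap).
Local Notation ca := (ca alpha kap).

Variable th : R.
Hypotheses (th0 : 0 < th) (thpi : th < pi).
Local Notation arg_int := (arg_int alpha kap nu th).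

(** th - corr u is the imaginary part of a primitive of 1 / zc with respect to
    Kc, namely of log zc + ((alpha - 1) / alpha) * (yc / zc). *)
Definition corr (u : R) : R :=
  (alpha - 1) / alpha * expR (- alpha * u) * sin (kap + alpha * th).

Lemma qc_over_zc (u : R) : qc u th / zc u th
  = 1 - (((alpha - 1) * expR (- alpha * u))%:C)%C * expi (- (kap + alpha * th)).
Proof.
have E : yc u th / zc u th
    = ((expR (- alpha * u))%:C)%C * expi (- (kap + alpha * th)).
  rewrite /yc /zc invfM expiN_inv.
  have -> : expR (- alpha * u) = expR (- (alpha - 1) * u) * (expR u)^-1.
    by rewrite -expRN -expRD; congr expR; ring.
  have -> : expi (- (kap + alpha * th)) = expi (- (kap + (alpha - 1) * th)) * expi (- th).
    by rewrite -expiD; congr expi; ring.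
  by rewrite rmorphM fmorphV mulrACA.
have -> : qc u th / zc u th = 1 - ((alpha - 1)%:C)%C * (yc u th / zc u th).
  by rewrite /qc mulrBl divff ?zc_neq0// mulrA.
by rewrite E rmorphM mulrA.
Qed.

Lemma Re_qc_over_zc (u : R) : cRe (qc u th / zc u th)
  = 1 - (alpha - 1) * (expR (- alpha * u) * cos (kap + alpha * th)).
Proof.
rewrite qc_over_zc cReD cReN cReM cReC cImC cRe_expi cosN mul0r subr0 mulrA.
by [].
Qed.

Lemma Im_qc_over_zc (u : R) : cIm (qc u th / zc u th)
  = (alpha - 1) * (expR (- alpha * u) * sin (kap + alpha * th)).
Proof.
rewrite qc_over_zc cImD cImN cImM cReC cImC cIm_expi sinN mul0r addr0 mulrN opprK mulrA.
by rewrite add0r.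
Qed.

Lemma is_derive_corr (u : R) : is_derive u 1 corr (- cIm (qc u th / zc u th)).
Proof.
have d := drvM (drvM (drvc ((alpha - 1) / alpha) u) (drv_comp (g := fun u => - alpha * u)
  (is_derive_expR (- alpha * u)) (drvM (drvc (- alpha) u) (is_derive_id u 1))))
  (drvc (sin (kap + alpha * th)) u).
apply: (drv_eq d); rewrite Im_qc_over_zc; field.
by rewrite gt_eqF// (lt_trans ltr01).
Qed.

Lemma arg_int_shift (u1 u v : R) : 0 < cIm (Kc u1 th) -> u1 < u -> u <= v ->
  arg_int u - corr u = arg_int v - corr v.
Proof.
move=> y1 u1u uv; apply/eqP; rewrite eq_sym -subr_eq0; apply/eqP.
have [||c _ ->] := @drv_MVT _ (fun s => arg_int s - corr s) (fun=> 0) u v; rewrite ?mul0r//.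
move=> s /andP[us _]; apply: (drv_eq (drvB
  (is_derive_arg_int alpha1 alpha2 kap0 kap1 nuE th0 thpi y1 (lt_le_trans u1u us))
  (is_derive_corr s))).
by rewrite subrr.
Qed.

Lemma cvg_expRN (a : R) : 0 < a -> expR (- a * n%:R) @[n --> \oo] --> 0.
Proof.
move=> a0; under eq_fun do rewrite expRM_natr.
by apply: cvg_expr; rewrite gtr0_norm ?expR_gt0// -expR0 ltr_expR oppr_lt0.
Qed.

Lemma atan_cot : atan (cos th / sin th) = pi / 2 - th.
Proof.
have <- : tan (pi / 2 - th) = cos th / sin th.
  by rewrite /tan -opprB sinN cosN sinBpihalf cosBpihalf opprK.
apply: tanK; rewrite in_itv /=; apply/andP; split; last by rewrite ltrBlDr ltrDl.
by move: thpi; lra.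
Qed.

(** At infinity on the ray, the argument of Kc - t tends to th for each t. *)
Lemma arg_int_cvg : arg_int n%:R @[n --> \oo] --> pi / 2 - th.
Proof.
have -> : pi / 2 - th = \int[nu]_t cst (pi / 2 - th) t.
  rewrite Rintegral_cst//= [X in fine X](_ : _ = 1%E) ?mulr1//.
  exact: probability_setT.
apply: (@bounded_cvg _ nu (fun n t => atan (cotan (Kc n%:R th) t)) _ (pi / 2)).
- by move=> n; exact: measurable_atan_cotan.
- by move=> n t; exact: atan_bound.
move=> t; rewrite /= -atan_cot.
apply: (@cvg_comp _ _ _ (fun n => cotan (Kc n%:R th) t) (@atan R) \oo
  (nbhs (cos th / sin th))); last exact: continuous_atan.
have -> : (fun n : nat => cotan (Kc n%:R th) t) = (fun n : nat =>
    (cos th + expR (- alpha * n%:R) * ca th - t * expR (- 1 * n%:R)) *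
    (sin th - expR (- alpha * n%:R) * sa th)^-1).
  apply/funext => n; rewrite /cotan Re_Kc Im_Kc.
  have -> : expR (- (alpha - 1) * n%:R) = expR n%:R * expR (- alpha * n%:R).
    by rewrite -expRD; congr expR; ring.
  have ef : expR n%:R * expR (- 1 * n%:R) = 1 :> R by rewrite mulN1r expRxMexpNx_1.
  set e := expR n%:R in ef *; set f := expR (- 1 * n%:R) in ef *.
  set E := expR (- alpha * n%:R).
  have -> : e * cos th + e * E * ca th - t = e * (cos th + E * ca th - t * f).
    by rewrite -[in LHS](mulr1 t) -ef; ring.
  have -> : e * sin th - e * E * sa th = e * (sin th - E * sa th) by ring.
  by rewrite invfM mulrACA divff ?mul1r// gt_eqF// expR_gt0.
have ca0 := cvg_expRN (lt_trans ltr01 alpha1).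
have c1 := cvg_expRN ltr01.
rewrite -[cos th / sin th]/(cos th * (sin th)^-1).
apply: cvgM.
  rewrite -[X in _ --> X]subr0 -[X in _ --> X - _]addr0.
  apply: cvgB; last by rewrite -(mulr0 t); apply: cvgM => //; exact: cvg_cst.
  apply: cvgD; first exact: cvg_cst.
  by rewrite -(mul0r (ca th)); apply: cvgM => //; exact: cvg_cst.
apply: cvgV; first by rewrite gt_eqF// sin_gt0_pi// th0.
rewrite -[X in _ --> X]subr0; apply: cvgB; first exact: cvg_cst.
by rewrite -(mul0r (sa th)); apply: cvgM => //; exact: cvg_cst.
Qed.

(** The constant of arg_int_shift is read off at infinity. *)
Lemma arg_intE (u1 u : R) : 0 < cIm (Kc u1 th) -> u1 < u ->
  arg_int u = pi / 2 - th + corr u.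
Proof.
move=> y1 u1u; apply/eqP; rewrite -subr_eq; apply/eqP.
have c0 : corr n%:R @[n --> \oo] --> 0.
  rewrite /corr -(mul0r (sin (kap + alpha * th))) -(mulr0 ((alpha - 1) / alpha)).
  apply: cvgM; last exact: cvg_cst.
  by apply: cvgM; [exact: cvg_cst|exact: cvg_expRN (lt_trans ltr01 alpha1)].
have lim : arg_int n%:R - corr n%:R @[n --> \oo] --> pi / 2 - th.
  by rewrite -[X in _ --> X]subr0; exact: (cvgB arg_int_cvg c0).
have lim' : arg_int n%:R - corr n%:R @[n --> \oo] --> arg_int u - corr u.
  apply: cvg_near_cst; near=> n.
  apply/esym/(arg_int_shift y1 u1u).
  by near: n; exact: nbhs_infty_ger.
by rewrite -(cvg_lim _ lim')// (cvg_lim _ lim).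
Unshelve. all: by end_near.
Qed.

End survival.

(** * Boundary values *)

Section sandwich.
Context {R : realType}.
Variables (alpha kap : R).
Hypotheses (alpha1 : 1 < alpha) (alpha2 : alpha < 2).
Hypotheses (kap0 : 0 <= kap) (kap1 : kap <= (2 - alpha) * pi).
Variable nu : probability (measurableTypeR R) R.
Hypothesis nuE : inverse_at_infinity alpha kap nu.
Local Notation Kc := (Kc alpha kap).
Variable th : R.
Hypotheses (th0 : 0 < th) (thpi : th < pi).
Local Notation corr := (corr alpha kap th).

Lemma cvg_atan_ratioy (a b : nat -> R) (l : R) : 0 < l ->
  a n @[n --> \oo] --> l -> b n @[n --> \oo] --> 0 -> (forall n, 0 < b n) ->
  atan (a n / b n) @[n --> \oo] --> pi / 2.
Proof.
move=> l0 al b0 bpos.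
apply: (@cvg_comp _ _ _ (fun n => a n / b n) (@atan R) \oo (pinfty_nbhs R));
  last exact: cvgy_atan.
apply/cvgryPge => A.
have A0 : 0 < `|A| + 1 by rewrite ltr_wpDl.
have h1 : \forall n \near \oo, l / 2 < a n.
  by apply: (cvgr_gt l al); rewrite ltr_pdivrMr//; lra.
have h2 : \forall n \near \oo, b n < l / (2 * (`|A| + 1)).
  by apply: (cvgr_lt 0 b0); rewrite divr_gt0// mulr_gt0.
near=> n; rewrite ler_pdivlMr//.
have ha : l / 2 < a n by near: n.
have hb : b n < l / (2 * (`|A| + 1)) by near: n.
move: hb; rewrite ltr_pdivlMr ?mulr_gt0// => hb.
have := ler_norm A; have := bpos n; nra.
Unshelve. all: by end_near.
Qed.

Variable u0 : R.
Hypothesis K0 : cIm (Kc u0 th) = 0.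
Local Notation X0 := (cRe (Kc u0 th)).

Let un (n : nat) : R := u0 + harmonic n.

Let un_gt (v : R) : u0 < v -> 0 < cIm (Kc v th).
Proof.
move=> uv; have := Im_Kc_incr alpha1 kap0 kap1 th0 thpi (ltW uv).
rewrite K0 subr0; apply: lt_le_trans.
by rewrite !mulr_gt0 ?expR_gt0 ?subr_gt0// sin_gt0_pi// th0.
Qed.

Let harm0 (n : nat) : (0 : R) < harmonic n. Proof. by rewrite invr_gt0. Qed.

Let cvg_un : un n @[n --> \oo] --> u0.
Proof.
rewrite -[X in _ --> X]addr0; apply: cvgD; [exact: cvg_cst|exact: cvg_harmonic].
Qed.

Let cvg_Re : cRe (Kc (un n) th) @[n --> \oo] --> X0.
Proof.
apply: (cvg_comp un (fun u => cRe (Kc u th)) cvg_un).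
by have [d _] := cderive_ray alpha kap th u0; exact: (drv_continuous d).
Qed.

Let cvg_Im : cIm (Kc (un n) th) @[n --> \oo] --> 0.
Proof.
rewrite -K0; apply: (cvg_comp un (fun u => cIm (Kc u th)) cvg_un).
by have [_ d] := cderive_ray alpha kap th u0; exact: (drv_continuous d).
Qed.

Let un_pos n : 0 < cIm (Kc (un n) th).
Proof. by apply: un_gt; rewrite ltrDl. Qed.

Let k n (t : measurableTypeR R) : R := pi / 2 - atan (cotan (Kc (un n) th) t).

Let mk n : measurable_fun setT (k n).
Proof.
by apply: measurable_funB => //; exact: measurable_atan_cotan.
Qed.

Let k_ge0 n t : 0 <= k n t.
Proof. by have := atan_bound (cotan (Kc (un n) th) t); rewrite /k ler_norml => /andP[]; lra. Qed.

Let k_lepi n t : k n t <= pi.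
Proof. by have := atan_bound (cotan (Kc (un n) th) t); rewrite /k ler_norml => /andP[]; lra. Qed.

Let int_k : \int[nu]_t k n t @[n --> \oo] --> th - corr u0.
Proof.
have -> : (fun n => \int[nu]_t k n t) = (fun n => th - corr (un n)).
  apply/funext => n; rewrite /k RintegralB//.
  - rewrite Rintegral_cst//= [X in fine X](_ : _ = 1%E); last exact: probability_setT.
    rewrite mulr1 -/(arg_int alpha kap nu th (un n)).
    rewrite (@arg_intE _ _ _ alpha1 alpha2 kap0 kap1 _ nuE _ th0 thpi (u0 + harmonic n / 2)).
    + by ring.
    + by apply: un_gt; rewrite ltrDl divr_gt0.
    + by rewrite ltrD2l ltr_pdivrMr// ltr_pMr// ltr1n.
  - exact: (finite_measure_integrable_cst nu _ measurableT).
  - apply: (@bounded_integrable _ nu _ (pi / 2)); first exact: measurable_atan_cotan.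
    by move=> t; exact: atan_bound.
apply: cvgB; first exact: cvg_cst.
by apply: (cvg_comp un corr cvg_un); exact: (drv_continuous (is_derive_corr kap alpha1 th u0)).
Qed.

Let k_gt t : X0 < t -> k n t @[n --> \oo] --> pi.
Proof.
move=> X0t.
have -> : (fun n => k n t) = (fun n => pi / 2 + atan ((t - cRe (Kc (un n) th)) / cIm (Kc (un n) th))).
  by apply/funext => n; rewrite /k /cotan -atanN -mulNr opprB.
rewrite [X in _ --> X](_ : pi = pi / 2 + pi / 2 :> R); last by field.
apply: cvgD; first exact: cvg_cst.
apply: (@cvg_atan_ratioy _ _ (t - X0)) => //; first by rewrite subr_gt0.
by apply: cvgB => //; exact: cvg_cst.
Qed.

Let k_lt t : t < X0 -> k n t @[n --> \oo] --> 0.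
Proof.
move=> X0t; rewrite [X in _ --> X](_ : 0 = pi / 2 - pi / 2 :> R); last by rewrite subrr.
apply: cvgB; first exact: cvg_cst.
apply: (@cvg_atan_ratioy _ _ (X0 - t)) => //; first by rewrite subr_gt0.
by apply: cvgB => //; exact: cvg_cst.
Qed.

(** As Kc tends to the real point X0 along the ray, the argument k n t of Kc - t
    tends to 0 for t < X0 and to pi for t > X0. At t = X0 only 0 <= k n t <= pi is
    known, hence an inequality on each side. *)
Lemma survival_sandwich :
  pr nu (`]X0, +oo[%classic) <= (th - corr u0) / pi <= pr nu (`[X0, +oo[%classic).
Proof.
have ki n : nu.-integrable setT (EFin \o k n).
  apply: (@bounded_integrable _ nu _ pi) => // t.
  by rewrite ger0_norm ?k_ge0 ?k_lepi.
have mA : measurable (`]X0, +oo[%classic : set (measurableTypeR R)) by [].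
have mB : measurable (`[X0, +oo[%classic : set (measurableTypeR R)) by [].
have pi0 := pi_gt0 R.
apply/andP; split.
- rewrite ler_pdivlMr// mulrC -Rintegral_indic_pr//.
  pose f n t := k n t * \1_(`]X0, +oo[%classic : set (measurableTypeR R)) t.
  have mf n : measurable_fun setT (f n) by apply: measurable_funM.
  have fb n t : `|f n t| <= pi.
    rewrite /f normrM ger0_norm ?k_ge0// indicE.
    by case: (_ \in _); rewrite ?normr1 ?mulr1 ?normr0 ?mulr0 ?k_lepi// ltW.
  have cf := bounded_cvg (nu := nu) mf fb (f := fun t => pi * \1_(`]X0, +oo[%classic) t).
  apply: (ler_cvg_to (cf _) int_k).
    move=> t; rewrite /f indicE; case: (boolP (_ \in _)) => [|_].
      rewrite inE /= in_itv /= andbT => /k_gt h.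
      by rewrite mulr1; under eq_fun do rewrite mulr1; exact: h.
    by rewrite mulr0; under eq_fun do rewrite mulr0; exact: cvg_cst.
  apply: nearW => n; apply: le_Rintegral => //.
    exact: (bounded_integrable nu (mf n) (fb n)).
  move=> t _; rewrite /f indicE; case: (_ \in _); rewrite ?mulr1// mulr0.
  exact: k_ge0.
- rewrite ler_pdivrMr// mulrC -Rintegral_indic_pr//.
  pose f n t := k n t * \1_(`]-oo, X0[%classic : set (measurableTypeR R)) t
    + pi * \1_(`[X0, +oo[%classic : set (measurableTypeR R)) t.
  have fE n t : f n t = if t < X0 then k n t else pi.
    rewrite /f !indicE; have [tX|tX] := ltP t X0.
      rewrite mem_set ?mulr1 /= ?in_itv//= memNset ?mulr0 ?addr0//=.
      by rewrite in_itv /= andbT leNgt tX.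
    rewrite memNset ?mulr0 ?add0r /= ?in_itv/=; last by apply/negP; rewrite -leNgt.
    by rewrite mem_set ?mulr1 //= in_itv /= tX.
  have mf n : measurable_fun setT (f n).
    by apply: measurable_funD; apply: measurable_funM.
  have fb n t : `|f n t| <= pi.
    rewrite fE; case: ifP => _; first by rewrite ger0_norm ?k_ge0 ?k_lepi.
    by rewrite gtr0_norm.
  have cf := bounded_cvg (nu := nu) mf fb (f := fun t => pi * \1_(`[X0, +oo[%classic) t).
  apply: (ler_cvg_to int_k (cf _)).
    move=> t; under eq_fun do rewrite fE; rewrite indicE.
    have [tX|tX] := ltP t X0.
      rewrite memNset ?mulr0 /=; first exact: k_lt.
      by rewrite in_itv /= andbT leNgt tX.
    by rewrite mem_set ?mulr1 /= ?in_itv /= ?tX//; exact: cvg_cst.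
  apply: nearW => n; apply: le_Rintegral => //.
    exact: (bounded_integrable nu (mf n) (fb n)).
  by move=> t _; rewrite fE; case: ifP => _ //; exact: k_lepi.
Qed.

End sandwich.

(** * The boundary curve *)

Section boundary.
Context {R : realType}.
Variables (alpha kap : R).
Hypotheses (alpha1 : 1 < alpha) (alpha2 : alpha < 2).
Hypotheses (kap0 : 0 <= kap) (kap1 : kap <= (2 - alpha) * pi).
Local Notation zc := (@zc R).
Local Notation Kc := (Kc alpha kap).
Local Notation qc := (qc alpha kap).
Local Notation sa := (sa alpha kap).
Local Notation ca := (ca alpha kap).
Implicit Types (th : R).

(** On the ray of argument th, Kc is real exactly at the modulus expR (ub th). *)
Definition ub th : R := (ln (sa th) - ln (sin th)) / alpha.
Definition xb th : R := cRe (Kc (ub th) th).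
(** The value of nu(]xb th, oo[), by survivalE. *)
Definition tail th : R := (th - corr alpha kap th (ub th)) / pi.
(** The value of - Im (1 / zc) / pi at the boundary point, by Im_inv_zc_ub. *)
Definition dens th : R := expR (- ub th) * sin th / pi.
(** The derivative of ub (see is_derive_ub). *)
Definition dub th : R := ((alpha - 1) * (ca th / sa th) - cos th / sin th) / alpha.

Let alpha_neq0 : alpha != 0.
Proof. by rewrite gt_eqF// (lt_trans ltr01). Qed.

Let sin_arg_gt0 th : 0 < th -> th < pi -> 0 < sin th.
Proof. by move=> th0 thpi; rewrite sin_gt0_pi// th0. Qed.

Let sa0 th : 0 < th -> th < pi -> 0 < sa th.
Proof. exact: sa_gt0. Qed.

Lemma expR_ub th : 0 < th -> th < pi ->
  expR (ub th) = expR (- (alpha - 1) * ub th) * (sa th / sin th).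
Proof.
move=> th0 thpi; have -> : sa th / sin th = expR (alpha * ub th).
  rewrite /ub mulrCA divff// mulr1 expRD expRN !lnK ?posrE//; [exact: sin_arg_gt0|exact: sa0].
by rewrite -expRD; congr expR; ring.
Qed.

Lemma Im_Kc_ub th : 0 < th -> th < pi -> cIm (Kc (ub th) th) = 0.
Proof.
move=> th0 thpi; rewrite Im_Kc expR_ub// -!mulrA mulVf ?mulr1 ?subrr//.
by rewrite gt_eqF// sin_arg_gt0.
Qed.

Lemma xbE th : 0 < th -> th < pi -> xb th =
  sin th `^ (- alpha^-1) * sa th `^ (alpha^-1 - 1) * sin (kap + alpha * th).
Proof.
move=> th0 thpi; have s0 := sin_arg_gt0 th0 thpi; have a0 := sa0 th0 thpi.
rewrite /xb Re_Kc expR_ub// /powR !gt_eqF//.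
have -> : kap + alpha * th = (kap + (alpha - 1) * th) + th by ring.
rewrite sinD -/(sa th) -/(ca th).
have -> : expR (- alpha^-1 * ln (sin th)) * expR ((alpha^-1 - 1) * ln (sa th))
    = expR (- (alpha - 1) * ub th) / sin th.
  rewrite -{2}[sin th]lnK ?posrE// -expRN -!expRD /ub; congr expR; field.
  exact: alpha_neq0.
by field; rewrite gt_eqF.
Qed.

Lemma densE th : 0 < th -> th < pi -> dens th =
  pi^-1 * sin th `^ (1 + alpha^-1) * sa th `^ (- alpha^-1).
Proof.
move=> th0 thpi; have s0 := sin_arg_gt0 th0 thpi; have a0 := sa0 th0 thpi.
have -> : dens th = pi^-1 * (expR (- ub th) * expR (ln (sin th))).
  by rewrite lnK ?posrE// /dens mulrC.
rewrite /powR !gt_eqF// -mulrA; congr (_ * _).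
rewrite -!expRD /ub; congr expR; field.
exact: alpha_neq0.
Qed.

Lemma dens_gt0 th : 0 < th -> th < pi -> 0 < dens th.
Proof. by move=> ? ?; rewrite divr_gt0 ?mulr_gt0 ?expR_gt0 ?sin_arg_gt0 ?pi_gt0. Qed.

Lemma Im_inv_zc_ub th : cIm (zc (ub th) th)^-1 = - (dens th * pi).
Proof.
rewrite /zc invfM expiN_inv -fmorphV -expRN cImM cImC mul0r addr0 cIm_expi sinN cReC.
by rewrite /dens divfK ?mulrN// gt_eqF ?pi_gt0.
Qed.

Lemma is_derive_ub th : 0 < th -> th < pi -> is_derive th 1 ub (dub th).
Proof.
move=> th0 thpi; have s0 := sin_arg_gt0 th0 thpi; have a0 := sa0 th0 thpi.
have dsa := drv_comp (g := fun t => kap + (alpha - 1) * t)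
  (is_derive_sin (kap + (alpha - 1) * th))
  (drvD (drvc kap th) (drvM (drvc (alpha - 1) th) (is_derive_id th 1))).
have d1 := drv_comp (g := sa) (is_derive1_ln a0) dsa.
have d2 := drv_comp (is_derive1_ln s0) (is_derive_sin th).
apply: (drv_eq (drvM (drvB d1 d2) (drvc alpha^-1 th))).
rewrite /dub /ca; move: a0; rewrite /sa => a0; field.
by rewrite alpha_neq0 !gt_eqF.
Qed.

Lemma cderive_boundary th : 0 < th -> th < pi ->
  cderive (fun t => Kc (ub t) t) th (qc (ub th) th * (dub th +i* 1)%C).
Proof.
move=> th0 thpi.
exact: (cderive_Kc alpha kap (is_derive_ub th0 thpi) (is_derive_id th 1)).
Qed.

(** The tangent of the boundary curve is real, because Im Kc is 0 there. *)
Lemma boundary_tangent th : 0 < th -> th < pi ->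
  cRe (qc (ub th) th) + dub th * cIm (qc (ub th) th) = 0.
Proof.
move=> th0 thpi; have s0 := sin_arg_gt0 th0 thpi; have a0 := sa0 th0 thpi.
rewrite Re_qc Im_qc expR_ub// /dub; field.
by rewrite alpha_neq0 !gt_eqF.
Qed.

(** The velocity qc * (dub + i) is real, so its two parts express it by Im qc
    alone; in this form its sign is visible. *)
Definition dxb th : R := - (dub th ^+ 2 + 1) * cIm (qc (ub th) th).

Lemma boundary_velocity th : 0 < th -> th < pi ->
  qc (ub th) th * (dub th +i* 1)%C = ((dxb th)%:C)%C.
Proof.
move=> th0 thpi; have := boundary_tangent th0 thpi; rewrite /dxb.
move: (qc _ _) (dub th) => q d h; apply: cplxP.
- rewrite cReM cReC /=; have -> : cRe q = - (d * cIm q) by apply/eqP; rewrite -addr_eq0 h.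
  by ring.
- by rewrite cImM cImC /= mulr1 [_ * d]mulrC.
Qed.

Lemma is_derive_xb th : 0 < th -> th < pi -> is_derive th 1 xb (dxb th).
Proof.
by move=> th0 thpi; have [+ _] := cderive_boundary th0 thpi; rewrite boundary_velocity.
Qed.

Lemma dxb_lt0 th : 0 < th -> th < pi -> dxb th < 0.
Proof.
move=> th0 thpi; rewrite /dxb mulNr oppr_lt0 mulr_gt0//.
  by rewrite ltr_wpDl// sqr_ge0.
exact: (Im_qc_gt0 alpha1 kap0 kap1).
Qed.

Lemma xb_decr th1 th2 : 0 < th1 -> th1 < th2 -> th2 < pi -> xb th2 < xb th1.
Proof.
move=> h1 h12 h2; have dE s : th1 <= s <= th2 -> 0 < s < pi.
  by move=> /andP[? ?]; apply/andP; split; lra.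
have [s /dE/andP[s0 spi] h] := drv_MVT (ltW h12)
  (fun s sE => let '(conj a b) := andP (dE s sE) in is_derive_xb a b).
by rewrite -subr_lt0 h pmulr_llt0 ?subr_gt0 ?dxb_lt0.
Qed.

(** The boundary value of Im (dKc / zc), with dKc = dxb real. *)
Lemma is_derive_tail th : 0 < th -> th < pi ->
  is_derive th 1 tail (- (dens th * dxb th)).
Proof.
move=> th0 thpi.
have dcorr : is_derive th 1 (fun t => corr alpha kap t (ub t))
    ((alpha - 1) * (expR (- alpha * ub th)) *
      (cos (kap + alpha * th) - dub th * sin (kap + alpha * th))).
  have d1 := drv_comp (g := fun t => - alpha * ub t) (is_derive_expR (- alpha * ub th))
    (drvM (drvc (- alpha) th) (is_derive_ub th0 thpi)).
  have d2 := drv_comp (g := fun t => kap + alpha * t) (is_derive_sin (kap + alpha * th))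
    (drvD (drvc kap th) (drvM (drvc alpha th) (is_derive_id th 1))).
  apply: (drv_eq (drvM (drvM (drvc ((alpha - 1) / alpha) th) d1) d2)).
  by field.
apply: (drv_eq (drvM (drvB (is_derive_id th 1) dcorr) (drvc pi^-1 th))).
suff key : 1 - (alpha - 1) * expR (- alpha * ub th) *
    (cos (kap + alpha * th) - dub th * sin (kap + alpha * th))
    = cIm (zc (ub th) th)^-1 * dxb th.
  rewrite key Im_inv_zc_ub mulr0 addr0; have := lt0r_neq0 (pi_gt0 R).
  by move: pi (dens th) (dxb th) => p d e p0; field.
have -> : cIm (zc (ub th) th)^-1 * dxb th = cIm ((zc (ub th) th)^-1 * ((dxb th)%:C)%C).
  by rewrite cImM cImC cReC mulr0 add0r.
rewrite -boundary_velocity//.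
have -> : (zc (ub th) th)^-1 * (qc (ub th) th * (dub th +i* 1)%C)
    = qc (ub th) th / zc (ub th) th * (dub th +i* 1)%C by ring.
by rewrite cImM Im_qc_over_zc// Re_qc_over_zc//=; ring.
Qed.

End boundary.

(** * The survival function, and the range of the boundary curve *)

Section survival_function.
Context {R : realType}.
Variables (alpha kap : R).
Hypotheses (alpha1 : 1 < alpha) (alpha2 : alpha < 2).
Hypotheses (kap0 : 0 <= kap) (kap1 : kap <= (2 - alpha) * pi).
Variable nu : probability (measurableTypeR R) R.
Hypothesis nuE : inverse_at_infinity alpha kap nu.
Local Notation xb := (xb alpha kap).
Local Notation tail := (tail alpha kap).
Implicit Types (th : R).

Lemma tail_continuous th : 0 < th -> th < pi -> {for th, continuous tail}.
Proof. by move=> th0 thpi; exact: drv_continuous (is_derive_tail alpha1 kap0 kap1 th0 thpi). Qed.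

Let sandwich th : 0 < th -> th < pi ->
  pr nu (`]xb th, +oo[%classic) <= tail th <= pr nu (`[xb th, +oo[%classic).
Proof.
move=> th0 thpi.
exact: (survival_sandwich alpha1 alpha2 kap0 kap1 nuE th0 thpi (Im_Kc_ub alpha1 kap0 kap1 th0 thpi)).
Qed.

(** The boundary point moves strictly with th, so that continuity of tail
    excludes atoms. *)
Lemma survivalE th : 0 < th -> th < pi ->
  pr nu (`]xb th, +oo[%classic) = tail th /\ pr nu (`[xb th, +oo[%classic) = tail th.
Proof.
move=> th0 thpi; have /andP[le1 le2] := sandwich th0 thpi.
have ct := tail_continuous th0 thpi.
have L : tail th <= pr nu (`]xb th, +oo[%classic).
  apply: (cvgr_to_le (f := tail) (F := th^'-)); first exact: cvg_at_left_filter ct.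
  near=> t.
  have t0 : 0 < t by near: t; exact: nbhs_left_gt.
  have tt : t < th by near: t; exact: nbhs_left_lt.
  have tpi : t < pi by exact: lt_trans tt thpi.
  have /andP[_] := sandwich t0 tpi; move/le_trans; apply; apply: pr_le => //.
  move=> x /=; rewrite !in_itv /= !andbT; apply: lt_le_trans.
  exact: (xb_decr alpha1 kap0 kap1).
have G : pr nu (`[xb th, +oo[%classic) <= tail th.
  apply: (cvgr_to_ge (f := tail) (F := th^'+)); first exact: cvg_at_right_filter ct.
  near=> t.
  have tt : th < t by near: t; exact: nbhs_right_gt.
  have tpi : t < pi by near: t; exact: nbhs_right_lt.
  have t0 : 0 < t by exact: lt_trans th0 tt.
  have /andP[h _] := sandwich t0 tpi; apply: le_trans h; apply: pr_le => //.
  move=> x /=; rewrite !in_itv /= !andbT; apply: lt_le_trans.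
  exact: (xb_decr alpha1 kap0 kap1).
split; apply/eqP; first by rewrite eq_le le1 L.
by rewrite eq_le G le2.
Unshelve. all: by end_near.
Qed.

End survival_function.

Section boundary_range.
Context {R : realType}.
Variables (alpha : R).
Hypotheses (alpha1 : 1 < alpha) (alpha2 : alpha < 2).
Implicit Types (th kap : R).

Let alpha_neq0 : alpha != 0.
Proof. by rewrite gt_eqF// (lt_trans ltr01). Qed.

Lemma sin_piB (x : R) : sin (pi - x) = sin x.
Proof. by rewrite sinB sinpi cospi mul0r sub0r mulN1r opprK. Qed.

Lemma sin_2piB (x : R) : sin (2 * pi - x) = - sin x.
Proof.
have -> : 2 * pi - x = pi - (x - pi) by ring.
by rewrite sin_piB sinB sinpi cospi mulr0 subr0 mulrN1.
Qed.

(** The reflection th -> pi - th of the upper half-plane exchanges rho and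
    1 - rho, that is kap and (2 - alpha) pi - kap. *)
Lemma sa_reflect kap th : sa alpha ((2 - alpha) * pi - kap) (pi - th) = sa alpha kap th.
Proof. by rewrite /sa -[RHS]sin_piB; congr sin; ring. Qed.

Lemma ub_reflect kap th : ub alpha ((2 - alpha) * pi - kap) (pi - th) = ub alpha kap th.
Proof. by rewrite /ub sa_reflect sin_piB. Qed.

Lemma xb_reflect kap th : 0 <= kap -> kap <= (2 - alpha) * pi -> 0 < th -> th < pi ->
  xb alpha ((2 - alpha) * pi - kap) (pi - th) = - xb alpha kap th.
Proof.
move=> kap0 kap1 th0 thpi; rewrite !xbE ?subr_ge0 ?gerBl ?subr_gt0 ?gtrBl//.
rewrite sa_reflect sin_piB -mulrN -sin_2piB; congr (_ * sin _).
by ring.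
Qed.

Lemma tail_reflect kap th :
  tail alpha ((2 - alpha) * pi - kap) (pi - th) = 1 - tail alpha kap th.
Proof.
rewrite /tail /corr ub_reflect.
have -> : (2 - alpha) * pi - kap + alpha * (pi - th) = 2 * pi - (kap + alpha * th) by ring.
rewrite sin_2piB; have := lt0r_neq0 (pi_gt0 R).
by move: (expR _) (sin _) pi => e s p p0; field; rewrite p0.
Qed.

Lemma cvg_sinM0 (a : R) : sin (a * x) @[x --> 0^'+] --> 0.
Proof.
apply: cvg_at_right_filter; have d := drv_comp (g := fun x => a * x)
  (is_derive_sin (a * 0)) (drvM (drvc a 0) (is_derive_id (0 : R) 1)).
by have := drv_continuous d; rewrite /prop_for /continuous_at mulr0 sin0.
Qed.

(** As th tends to 0, sin th ^ (- 1 / alpha) tends to infinity, while the second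
    factor of xb is at least 1 and the last one tends to sin kap > 0. *)
Lemma xb_unbounded kap (M : R) : 0 < kap -> kap <= (2 - alpha) * pi ->
  exists th, [/\ 0 < th, th < pi & M < xb alpha kap th].
Proof.
move=> kap0 kap1; have kpi : kap < pi.
  apply: (le_lt_trans kap1); rewrite gtr_pMl ?pi_gt0//.
  by rewrite ltrBlDr -ltrBlDl; move: alpha1; lra.
have sk : 0 < sin kap by rewrite sin_gt0_pi// kap0.
pose A := (`|M| + 1) / (sin kap / 2).
have A0 : 0 < A by rewrite divr_gt0 ?divr_gt0// ltr_wpDl.
have c1 : sin (kap + alpha * x) @[x --> (0:R)^'+] --> sin kap.
  apply: cvg_at_right_filter; have d := drv_comp (g := fun x => kap + alpha * x)
    (is_derive_sin (kap + alpha * 0))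
    (drvD (drvc kap 0) (drvM (drvc alpha 0) (is_derive_id (0 : R) 1))).
  by have := drv_continuous d; rewrite /prop_for /continuous_at mulr0 addr0.
have c2 : sin x @[x --> (0:R)^'+] --> 0.
  by have := @cvg_sinM0 1; under eq_fun do rewrite mul1r.
have n1 : \forall x \near (0:R)^'+, sin kap / 2 < sin (kap + alpha * x).
  by apply: (cvgr_gt _ c1); rewrite ltr_pdivrMr//; lra.
have n2 : \forall x \near (0:R)^'+, sin x < expR (- alpha * ln A).
  by apply: (cvgr_lt _ c2); exact: expR_gt0.
have : \forall x \near (0:R)^'+, [/\ 0 < x, x < pi, sin kap / 2 < sin (kap + alpha * x) &
    sin x < expR (- alpha * ln A)].
  near=> x; split; near: x => //; [exact: nbhs_right_gt|].
  by apply: nbhs_right_lt; exact: pi_gt0.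
move=> /filter_ex[th [th0 thpi h1 h2]]; exists th; split => //.
rewrite xbE// ?(ltW kap0)//.
have sth : 0 < sin th by rewrite sin_gt0_pi// th0.
have s0 : 0 < sa alpha kap th by rewrite sa_gt0// ltW.
have P1 : A <= sin th `^ (- alpha^-1).
  rewrite /powR gt_eqF// -[A in A <= _]lnK ?posrE// ler_expR.
  have : ln (sin th) <= - alpha * ln A.
    by rewrite -ler_expR lnK ?posrE// ltW.
  rewrite mulNr -(ler_pM2l (x := alpha^-1)) ?invr_gt0 ?(lt_trans ltr01)//.
  by rewrite mulNr mulrN mulKf//; lra.
have P2 : 1 <= sa alpha kap th `^ (alpha^-1 - 1).
  rewrite /powR gt_eqF// -[leLHS]expR0 ler_expR mulr_le0//.
    by rewrite subr_le0 invf_le1 ?(lt_trans ltr01)// ltW.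
  by rewrite ln_le0// sin_le1.
have P3 : A <= sin th `^ (- alpha^-1) * sa alpha kap th `^ (alpha^-1 - 1).
  by rewrite -[leLHS]mulr1; apply: ler_pM => //; exact: ltW.
apply: (@lt_le_trans _ _ (A * (sin kap / 2))).
  by rewrite /A divfK ?gt_eqF ?divr_gt0// (le_lt_trans (ler_norm M))// ltrDl.
by apply: ler_pM => //; [exact: ltW|rewrite ltW// divr_gt0|exact: ltW].
Unshelve. all: by end_near.
Qed.

Lemma xb_surj kap th1 th2 (x : R) : 0 <= kap -> kap <= (2 - alpha) * pi ->
  0 < th1 -> th1 < pi -> 0 < th2 -> th2 < pi ->
  x <= xb alpha kap th1 -> xb alpha kap th2 <= x ->
  exists th, [/\ 0 < th, th < pi & xb alpha kap th = x].
Proof.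
move=> kap0 kap1 h1 h1' h2 h2' x1 x2.
have h12 : th1 <= th2.
  rewrite leNgt; apply/negP => h; have := xb_decr alpha1 kap0 kap1 h2 h h1'.
  by rewrite ltNge (le_trans x2).
have in_ s : th1 <= s <= th2 -> 0 < s < pi.
  by move=> /andP[? ?]; apply/andP; split; lra.
have cx : {within `[th1, th2], continuous (xb alpha kap)}.
  apply: (@drv_within _ _ (dxb alpha kap)) => s /in_/andP[? ?].
  exact: is_derive_xb.
have [|th] := IVT h12 cx (v := x).
  by rewrite ge_min x2 orbT le_max x1.
by rewrite in_itv => /in_/andP[? ?] ?; exists th.
Qed.

Lemma xb_inj kap th1 th2 : 0 <= kap -> kap <= (2 - alpha) * pi ->
  0 < th1 -> th1 < pi -> 0 < th2 -> th2 < pi ->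
  xb alpha kap th1 = xb alpha kap th2 -> th1 = th2.
Proof.
move=> kap0 kap1 h1 h1' h2 h2' e; have [h|h|//] := ltgtP th1 th2.
- by have := xb_decr alpha1 kap0 kap1 h1 h h2'; rewrite e ltxx.
- by have := xb_decr alpha1 kap0 kap1 h2 h h1'; rewrite e ltxx.
Qed.

Lemma xb_unbounded_below kap (M : R) : 0 <= kap -> kap < (2 - alpha) * pi ->
  exists th, [/\ 0 < th, th < pi & xb alpha kap th < M].
Proof.
move=> kap0 kap1; have [||th [th0 thpi h]] :=
  @xb_unbounded ((2 - alpha) * pi - kap) (- M); rewrite ?subr_gt0 ?gerBl//.
exists (pi - th); rewrite subr_gt0 gtrBl; split => //.
have e : (2 - alpha) * pi - ((2 - alpha) * pi - kap) = kap by rewrite opprB addrC subrK.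
have := @xb_reflect ((2 - alpha) * pi - kap) th.
by rewrite e subr_ge0 (ltW kap1) gerBl => -> //; rewrite ltrNl.
Qed.

End boundary_range.

(** * The edge of the support for rho = 0 *)

Section extreme_case.
Context {R : realType}.
Variables (alpha : R).
Hypotheses (alpha1 : 1 < alpha) (alpha2 : alpha < 2).
Implicit Types (th : R).
Local Notation xb := (xb alpha 0).
Local Notation tail := (tail alpha 0).

Definition edge : R := alpha * (alpha - 1) `^ (alpha^-1 - 1).

Let kap1 : 0 <= (2 - alpha) * pi.
Proof. by rewrite mulr_ge0 ?subr_ge0 ?pi_ge0// ltW. Qed.

(** sin (a x) / x, continuously extended by a at 0. *)
Lemma sinM_slope (a : R) : exists g : R -> R,
  [/\ forall x, sin (a * x) = g x * x, {for 0, continuous g} & g 0 = a].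
Proof.
have d := drv_comp (g := fun x => a * x) (is_derive_sin (a * 0))
  (drvM (drvc a 0) (is_derive_id (0 : R) 1)).
have /is_derive1_caratheodory[g [gE gc g0]] := d.
exists g; split => //.
  by move=> x; have := gE x; rewrite mulr0 sin0 !subr0.
by rewrite g0 mulr0 cos0; ring.
Qed.

Lemma cvg_expR_ln (g : R -> R) (c l : R) : 0 < l -> {for 0, continuous g} -> g 0 = l ->
  expR (c * ln (g x)) @[x --> 0^'+] --> expR (c * ln l).
Proof.
move=> l0 gc gl; apply: cvg_at_right_filter.
have cl : ln (g x) @[x --> 0] --> ln l.
  apply: (@cvg_comp _ _ _ g (@ln R) (nbhs 0) (nbhs l)).
    by rewrite -gl; exact: gc.
  exact: continuous_ln.
apply: (@cvg_comp _ _ _ (fun x => c * ln (g x)) (@expR R) (nbhs 0) (nbhs (c * ln l))).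
  by apply: cvgM => //; exact: cvg_cst.
exact: continuous_expR.
Qed.

(** After writing each sine as a slope times th, the powers of th cancel. *)
Lemma xb_cvg_edge : xb th @[th --> 0^'+] --> edge.
Proof.
have [g1 [g1E g1c g10]] := sinM_slope 1.
have [gb [gbE gbc gb0]] := sinM_slope (alpha - 1).
have [ga [gaE gac ga0]] := sinM_slope alpha.
have -> : edge = expR (- alpha^-1 * ln 1) * expR ((alpha^-1 - 1) * ln (alpha - 1)) * alpha.
  by rewrite ln1 mulr0 expR0 mul1r mulrC /edge /powR subr_eq0 gt_eqF.
have L : expR (- alpha^-1 * ln (g1 x)) * expR ((alpha^-1 - 1) * ln (gb x)) * ga x
    @[x --> 0^'+] --> expR (- alpha^-1 * ln 1) * expR ((alpha^-1 - 1) * ln (alpha - 1)) * alpha.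
  apply: cvgM; last by rewrite -[X in _ --> X]ga0; exact: cvg_at_right_filter gac.
  apply: cvgM; first exact: cvg_expR_ln ltr01 g1c g10.
  by apply: cvg_expR_ln gbc gb0; rewrite subr_gt0.
apply: cvg_trans L; apply: near_eq_cvg; near=> x.
have x0 : 0 < x by near: x; exact: nbhs_right_gt.
have xpi : x < pi by near: x; apply: nbhs_right_lt; exact: pi_gt0.
have s0 : 0 < sin x by rewrite sin_gt0_pi// x0.
have a0 : 0 < sa alpha 0 x by rewrite sa_gt0.
have g1E' : sin x = g1 x * x by rewrite -g1E mul1r.
have gbE' : sa alpha 0 x = gb x * x by rewrite -gbE /sa add0r.
have g1pos : 0 < g1 x by move: s0; rewrite g1E' pmulr_lgt0.
have gbpos : 0 < gb x by move: a0; rewrite gbE' pmulr_lgt0.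
rewrite xbE// /powR !gt_eqF// add0r gaE g1E' gbE' !lnM ?posrE//.
have -> : expR (- alpha^-1 * (ln (g1 x) + ln x)) * expR ((alpha^-1 - 1) * (ln (gb x) + ln x))
  = expR (- alpha^-1 * ln (g1 x)) * expR ((alpha^-1 - 1) * ln (gb x)) * expR (- ln x).
  by rewrite -!expRD; congr expR; ring.
by rewrite expRN lnK ?posrE//; field; rewrite gt_eqF.
Unshelve. all: by end_near.
Qed.

Lemma xb_lt_edge th : 0 < th -> th < pi -> xb th < edge.
Proof.
move=> th0 thpi; have h0 : 0 < th / 2 by rewrite divr_gt0.
have h1 : th / 2 < th by rewrite ltr_pdivrMr// ltr_pMr// ltr1n.
apply: (lt_le_trans (xb_decr alpha1 (lexx 0) kap1 h0 h1 thpi)).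
apply: (cvgr_to_ge xb_cvg_edge); near=> t.
have t0 : 0 < t by near: t; exact: nbhs_right_gt.
have tth : t < th / 2 by near: t; exact: nbhs_right_lt.
apply/ltW/(xb_decr alpha1 (lexx 0) kap1) => //.
exact: lt_trans thpi.
Unshelve. all: by end_near.
Qed.

(** Near the edge: boundary points beyond any x < edge, of arbitrarily small
    angle. *)
Lemma xb_near_edge (x d : R) : x < edge -> 0 < d ->
  exists th, [/\ 0 < th, th < pi, th < d & x < xb th].
Proof.
move=> xe d0.
have : \forall th \near (0:R)^'+, [/\ 0 < th, th < pi, th < d & x < xb th].
  near=> t; split; near: t.
  - exact: nbhs_right_gt.
  - by apply: nbhs_right_lt; exact: pi_gt0.
  - exact: nbhs_right_lt.
  - by apply: (cvgr_gt _ xb_cvg_edge).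
by move=> /filter_ex.
Unshelve. all: by end_near.
Qed.

Lemma tail_le th : 0 < th -> th < pi / alpha -> tail th <= th / pi.
Proof.
move=> th0 thpi; rewrite /tail ler_pM2r ?invr_gt0 ?pi_gt0// gerBl /corr.
have a0 : 0 < alpha by exact: lt_trans ltr01 alpha1.
rewrite !mulr_ge0 ?expR_ge0 ?invr_ge0 ?subr_ge0 ?(ltW alpha1) ?(ltW a0)//.
rewrite add0r sin_ge0_pi// mulr_ge0 ?(ltW a0) ?(ltW th0)//=.
by move: thpi; rewrite ltr_pdivlMr// mulrC => /ltW.
Qed.

End extreme_case.

(** * The density as a function on the line *)

Section inverse_boundary.
Context {R : realType}.
Variables (alpha kap : R).
Hypotheses (alpha1 : 1 < alpha) (alpha2 : alpha < 2).
Hypotheses (kap0 : 0 <= kap) (kap1 : kap <= (2 - alpha) * pi).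
Local Notation xb := (xb alpha kap).
Local Notation dxb := (dxb alpha kap).
Local Notation dens := (dens alpha kap).
Local Notation tail := (tail alpha kap).
Local Notation ub := (ub alpha kap).
Local Notation dub := (dub alpha kap).
Implicit Types (th x : R).

Definition branch x : set R := [set th | [/\ 0 < th, th < pi & xb th = x]].

(** The default value 0 makes psi vanish outside of the range of xb. *)
Definition thb x : R := xget 0 (branch x).
Definition psi x : R := dens (thb x).

Lemma thbP x : branch x !=set0 -> [/\ 0 < thb x, thb x < pi & xb (thb x) = x].
Proof. by move=> /(xgetPex 0). Qed.

Lemma branch_xb th : 0 < th -> th < pi -> branch (xb th) !=set0.
Proof. by exists th. Qed.

Lemma thbK th : 0 < th -> th < pi -> thb (xb th) = th.
Proof.
move=> th0 thpi; have [h1 h2 h3] := thbP (branch_xb th0 thpi).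
exact: (xb_inj alpha1 kap0 kap1).
Qed.

Lemma psi_out x : ~ (branch x !=set0) -> psi x = 0.
Proof.
move=> nx; rewrite /psi /thb xgetPN; first by rewrite /dens sin0 mulr0 mul0r.
by move=> th bth; apply: nx; exists th.
Qed.

Lemma psiE x th : branch x th -> psi x = dens th.
Proof. by move=> [th0 thpi <-]; rewrite /psi thbK. Qed.

Lemma psi_gt0 x : branch x !=set0 -> 0 < psi x.
Proof. by move=> /thbP[? ? _]; exact: dens_gt0. Qed.

Lemma psi_ge0 x : 0 <= psi x.
Proof.
by have [/psi_gt0/ltW//|/psi_out ->] := pselect (branch x !=set0).
Qed.

Lemma branch_itv a c x : branch a !=set0 -> branch c !=set0 -> a <= x <= c ->
  branch x !=set0.
Proof.
move=> [tha [a0 api aE]] [thc [c0 cpi cE]] /andP[ax xc].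
have [||th [h1 h2 h3]] := xb_surj alpha1 kap0 kap1 c0 cpi a0 api (x := x);
  rewrite ?aE ?cE//.
by exists th.
Qed.

Lemma branch_nbhs x : branch x !=set0 -> exists2 h, 0 < h &
  forall s, `|s - x| < h -> branch s !=set0.
Proof.
move=> [th [th0 thpi <-]].
have h0 : 0 < th / 2 by rewrite divr_gt0.
have h1 : th / 2 < th by rewrite ltr_pdivrMr// ltr_pMr// ltr1n.
have h2 : th < (th + pi) / 2 by rewrite midf_lt.
have h3 : (th + pi) / 2 < pi by rewrite midf_lt.
have d1 := xb_decr alpha1 kap0 kap1 h0 h1 thpi.
have d2 := xb_decr alpha1 kap0 kap1 th0 h2 h3.
exists (Num.min (xb (th / 2) - xb th) (xb th - xb ((th + pi) / 2))).
  by rewrite lt_min !subr_gt0 d1.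
move=> s; rewrite lt_min !ltr_distl => /andP[/andP[_ s1] /andP[s2 _]].
apply: (@branch_itv (xb ((th + pi) / 2)) (xb (th / 2))).
- by apply: branch_xb => //; exact: lt_trans h2.
- by apply: branch_xb => //; exact: lt_trans h1 _.
- by apply/andP; split; lra.
Qed.

Lemma is_derive_thb x : branch x !=set0 -> is_derive x 1 thb (dxb (thb x))^-1.
Proof.
move=> bx; have [th0 thpi xE] := thbP bx; rewrite -{1}xE.
have near_itv : \forall t \near thb x, 0 < t < pi.
  have c : t @[t --> thb x] --> thb x by exact: cvg_id.
  by near=> t; apply/andP; split; near: t; [apply: (cvgr_gt _ c)|apply: (cvgr_lt _ c)].
apply: is_derive_inverse.
- by apply: filterS near_itv => t /andP[? ?]; rewrite thbK.
- apply: filterS near_itv => t /andP[t0 tpi].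
  exact: (drv_continuous (is_derive_xb alpha1 kap0 kap1 t0 tpi)).
- exact: is_derive_xb.
- by rewrite lt_eqF// (dxb_lt0 alpha1 kap0 kap1).
Unshelve. all: by end_near.
Qed.

Lemma psi_continuous x : branch x !=set0 -> {for x, continuous psi}.
Proof.
move=> bx; have [th0 thpi _] := thbP bx.
have dd := drvM (drvM (drv_comp (g := fun t => 0 - ub t) (is_derive_expR (0 - ub (thb x)))
  (drvB (drvc 0 _) (is_derive_ub alpha1 kap0 kap1 th0 thpi)))
  (is_derive_sin (thb x))) (drvc pi^-1 (thb x)).
have -> : psi = fun t => expR (0 - ub (thb t)) * sin (thb t) / pi.
  by apply/funext => t; rewrite sub0r.
exact: drv_continuous (drv_comp dd (is_derive_thb bx)).
Qed.

Lemma is_derive_tail_thb x : branch x !=set0 ->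
  is_derive x 1 (fun x => tail (thb x)) (- psi x).
Proof.
move=> bx; have [th0 thpi _] := thbP bx.
have d := drv_comp (is_derive_tail alpha1 kap0 kap1 th0 thpi) (is_derive_thb bx).
apply: (drv_eq d); rewrite /psi mulNr mulfK// lt_eqF//.
exact: (dxb_lt0 alpha1 kap0 kap1).
Qed.

(** When the boundary is parametrized by the real value x of Kc, the expansion of
    1 / zc in powers of Kc becomes a complex power series in x; psi is - 1 / pi
    times its imaginary part. *)
Lemma psi_analytic x : branch x !=set0 -> real_analytic_at psi x.
Proof.
move=> bx; have [h h0 bh] := branch_nbhs bx.
have KE s : branch s !=set0 -> Kc alpha kap (ub (thb s)) (thb s) = (s%:C)%C.
  move=> /thbP[th0 thpi sE]; apply: cplxP; first by rewrite cReC -[RHS]sE.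
  by rewrite cImC (Im_Kc_ub alpha1 kap0 kap1).
have [|s sh|e [C [L [d [d0 C0 L0 He]]]]] := @expansible_polar _ alpha kap
  alpha1 alpha2 kap0 kap1 (fun s => ub (thb s)) thb
  (fun s => dub (thb s) * (dxb (thb s))^-1) (fun s => (dxb (thb s))^-1) x h 1.
- by [].
- have bs := bh s sh; have [th0 thpi _] := thbP bs.
  split => //.
  + exact: (drv_comp (is_derive_ub alpha1 kap0 kap1 th0 thpi) (is_derive_thb bs)).
  + exact: is_derive_thb.
  + have -> : (dub (thb s) / dxb (thb s) +i* (dxb (thb s))^-1)%C =
        (dub (thb s) +i* 1)%C * (((dxb (thb s))^-1)%:C)%C.
      move: (dub _) (_^-1) => p q.
      by apply: cplxP; [rewrite cReM|rewrite cImM]; rewrite /=; ring.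
    rewrite mulrA (boundary_velocity alpha1 kap0 kap1 th0 thpi) -rmorphM divff ?normcC ?normr1//.
    by rewrite lt_eqF// (dxb_lt0 alpha1 kap0 kap1).
exists (fun n => - cIm (e n) / pi), (Num.min h (Num.min d (1 / (2 * (L + 1))))).
  by rewrite !lt_min h0 d0 divr_gt0// mulr_gt0// ltr_wpDl.
move=> s; rewrite !lt_min => /and3P[sh sd sL].
have bs := bh s sh.
have psiI : psi s = - cIm (zc (ub (thb s)) (thb s))^-1 / pi.
  by rewrite Im_inv_zc_ub opprK mulfK ?gt_eqF ?pi_gt0.
have bnd N : `|psi s - pseries (fun n => - cIm (e n) / pi) (s - x) N| <= C / pi * 2^-1 ^+ N.
  have := He s N sd; rewrite !KE// -rmorphB.
  have -> : psi s - pseries (fun n => - cIm (e n) / pi) (s - x) N = - (pi^-1 *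
    cIm ((zc (ub (thb s)) (thb s))^-1 - \sum_(n < N) e n * (((s - x)%:C)%C) ^+ n)).
    rewrite psiI; move: ((zc (ub (thb s)) (thb s))^-1) => z.
    rewrite cImD cImN cIm_sum /pseries /series /= big_mkord.
    have -> : \sum_(i < N) - cIm (e i) / pi * (s - x) ^+ i
        = - (pi^-1 * \sum_(i < N) cIm (e i * ((s - x)%:C)%C ^+ i)).
      rewrite mulr_sumr -sumrN; apply: eq_bigr => n _.
      rewrite -rmorphXn cImM cReC cImC mulr0 add0r.
      by move: (pi^-1 : R) => p; ring.
    by rewrite opprK mulrDr mulrN opprD opprK mulNr [_ / pi]mulrC.
  move=> b; rewrite normrN normrM ger0_norm ?invr_ge0 ?pi_ge0//.
  rewrite [C / pi]mulrC -mulrA ler_wpM2l ?invr_ge0 ?pi_ge0//.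
  apply: (le_trans (cIm_le_normc _)); apply: (le_trans b).
  apply: ler_wpM2l => //; rewrite lerXn2r ?nnegrE ?invr_ge0 ?mulr_ge0//.
  move: sL; rewrite ltr_pdivlMr ?mulr_gt0 ?ltr_wpDl//.
  have : 0 <= `|s - x| by []; nra.
have : C / pi * (2^-1 : R) ^+ N @[N --> \oo] --> C / pi * 0.
  by apply: cvgMr; apply: cvg_expr; rewrite gtr0_norm ?invf_lt1//; lra.
rewrite mulr0 => lim; apply/cvgrPdist_le => eps eps0.
move/cvgrPdist_le : lim => /(_ _ eps0); apply: filterS => N.
rewrite sub0r normrN ger0_norm; first exact: le_trans (bnd N).
by rewrite mulr_ge0 ?divr_ge0 ?exprn_ge0 ?pi_ge0.
Qed.

Lemma integral_psi a c : a < c -> branch a !=set0 -> branch c !=set0 ->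
  (\int[lebesgue_measure]_(x in `[a, c]) (psi x)%:E = (tail (thb a) - tail (thb c))%:E)%E.
Proof.
move=> ac ba bc.
have b s : a <= s <= c -> branch s !=set0 by exact: branch_itv.
have dF s : a <= s <= c -> is_derive s 1 (fun x => 0 - tail (thb x)) (psi s).
  move=> /b bs; apply: (drv_eq (drvB (drvc 0 s) (is_derive_tail_thb bs))).
  by rewrite sub0r opprK.
rewrite (@continuous_FTC2 _ psi (fun x => 0 - tail (thb x)) a c ac).
- by rewrite -EFinB; congr EFin; ring.
- apply: continuous_in_subspaceT => x /set_mem /=; rewrite in_itv /= => /b bx.
  exact: psi_continuous.
- have cF s : a <= s <= c -> {for s, continuous (fun x => 0 - tail (thb x))}.
    by move=> sE; exact: drv_continuous (dF s sE).
  split.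
  + move=> s; rewrite in_itv /= => /andP[s1 s2].
    have sac : a <= s <= c by rewrite !ltW.
    by have [] := dF s sac.
  + by apply: cvg_at_right_filter; apply: cF; rewrite lexx ltW.
  + by apply: cvg_at_left_filter; apply: cF; rewrite lexx ltW.
- move=> s; rewrite in_itv /= => /andP[s1 s2]; rewrite derive1E.
  have sac : a <= s <= c by rewrite !ltW.
  by have [_ ->] := dF s sac.
Qed.

End inverse_boundary.

(** * Measures on the line *)

Section measures_on_the_line.
Context {R : realType}.
Implicit Types (m : {measure set (measurableTypeR R) -> \bar R}).

Lemma measure_ext_ocitv m1 m2 :
  (forall a c : R, a < c -> m1 `]a, c]%classic = m2 `]a, c]%classic) ->
  (forall a c : R, (m1 `]a, c]%classic < +oo)%E) ->
  forall A, measurable A -> m1 A = m2 A.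
Proof.
move=> m12 fin.
apply: (@measure_unique _ R (measurableTypeR R) (@ocitv R)
  (fun n : nat => `](- n%:R : R), n%:R]%classic) _ _ _ _ m1 m2).
- by [].
- exact: ocitvI.
- by move=> n; exact: is_ocitv.
- apply/seteqP; split => // x _; exists (Num.truncn `|x|).+1 => //=.
  have := truncnS_gt `|x|; rewrite in_itv /= => h.
  by move: (h); rewrite ltr_norml => /andP[-> /ltW].
- move=> _ [[a c] _ <-] /=; have [ac|ca] := ltP a c; first exact: m12.
  by rewrite set_itv_ge ?bnd_simp -?leNgt// !measure0.
- by move=> n; exact: fin.
Qed.

(** ]a, b[ is the increasing union of the intervals ]a, b - (b - a) / (n + 2)]. *)
Lemma measure_ext_open m1 m2 (a b : R) : a < b ->
  (forall c, a < c -> c < b -> m1 `]a, c]%classic = m2 `]a, c]%classic) ->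
  m1 `]a, b[%classic = m2 `]a, b[%classic.
Proof.
move=> ab m12; pose F (n : nat) : set (measurableTypeR R) :=
  `]a, b - (b - a) / n.+2%:R]%classic.
have step n : 0 < (b - a) / n.+2%:R < b - a.
  rewrite divr_gt0 ?subr_gt0//= ltr_pdivrMr// ltr_pMr ?subr_gt0// ltr1n.
  by [].
have FE : \bigcup_n F n = `]a, b[%classic.
  apply/seteqP; split => x.
    move=> [n _]; rewrite /F /= !in_itv /= => /andP[-> h] /=.
    by apply: (le_lt_trans h); rewrite gtrBl; have /andP[] := step n.
  rewrite /= in_itv /= => /andP[ax xb].
  exists (Num.truncn ((b - a) / (b - x))) => //; rewrite /F /= in_itv /= ax /=.
  have bx : 0 < b - x by rewrite subr_gt0.
  have := truncnS_gt ((b - a) / (b - x)); set k := Num.truncn _.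
  rewrite ltr_pdivrMr// => h.
  rewrite lerBrDr -lerBrDl ler_pdivrMr ?ltr0n// mulrC.
  apply: (le_trans (ltW h)); rewrite ler_wpM2r ?(ltW bx)// ler_nat.
  by [].
have mF n : measurable (F n) by exact: measurable_itv.
have mUF : measurable (\bigcup_n F n) by rewrite FE; exact: measurable_itv.
have ndF : nondecreasing_seq F.
  move=> n p np; apply/subsetPset => x; rewrite /F /= !in_itv /= => /andP[-> /le_trans] /=.
  apply; rewrite lerD2l lerN2 ler_wpM2l ?subr_ge0 ?(ltW ab)//.
  by rewrite lef_pV2 ?posrE ?ltr0n// ler_nat !ltnS.
have c1 := nondecreasing_cvg_mu (mu := m1) mF mUF ndF.
have c2 := nondecreasing_cvg_mu (mu := m2) mF mUF ndF.
have E : m1 \o F = m2 \o F.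
  apply/funext => n /=; apply: m12; have /andP[h1 h2] := step n; last by rewrite gtrBl.
  by move: h2; rewrite ltrBrDr addrC -ltrBrDr.
rewrite -FE -(cvg_lim _ c1)// -(cvg_lim _ c2)// E.
by [].
Qed.

Section density_measure.
Variable f : R -> R.
Hypothesis mf : measurable_fun (setT : set (measurableTypeR R)) f.
Hypothesis f0 : forall x, 0 <= f x.

Definition dmeas (A : set (measurableTypeR R)) : \bar R :=
  (\int[lebesgue_measure]_(x in A) (f x)%:E)%E.

Let dmeas0 : dmeas set0 = 0%E.
Proof. by rewrite /dmeas integral_set0. Qed.

Let dmeas_ge0 A : (0 <= dmeas A)%E.
Proof. by apply: integral_ge0 => x _; rewrite lee_fin. Qed.

Let dmeas_sigma_additive : semi_sigma_additive dmeas.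
Proof.
move=> /= A mA tA mUA; rewrite /dmeas ge0_integral_bigcup//=; first last.
- by move=> x _; rewrite lee_fin.
- by apply/measurable_EFinP; apply: measurable_funTS.
apply: is_cvg_ereal_nneg_natsum_cond => n _ _.
by apply: integral_ge0 => /= x ?; rewrite lee_fin.
Qed.

HB.instance Definition _ := isMeasure.Build _ _ _
  dmeas dmeas0 dmeas_ge0 dmeas_sigma_additive.

Definition density_measure : {measure set (measurableTypeR R) -> \bar R} := dmeas.

Lemma density_measureE A :
  density_measure A = (\int[lebesgue_measure]_(x in A) (f x)%:E)%E.
Proof. by []. Qed.

End density_measure.
End measures_on_the_line.

Lemma probability_ext {R : realType} (m1 m2 : probability (measurableTypeR R) R) :
  (forall x : R, pr m1 `]x, +oo[%classic = pr m2 `]x, +oo[%classic) ->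
  forall A, measurable A -> m1 A = m2 A.
Proof.
move=> m12; apply: measure_ext_ocitv => a c.
  move=> /ltW ac; have mI : measurable (`]a, c]%classic : set (measurableTypeR R)) by [].
  apply: (etrans (prE m1 mI)); apply/esym/(etrans (prE m2 mI)).
  by rewrite !pr_ocitv// !m12.
exact: (probability_lty m1 (measurable_itv _)).
Qed.

(** * Identification of the measure *)

Section identification.
Context {R : realType}.
Variables (alpha kap : R).
Hypotheses (alpha1 : 1 < alpha) (alpha2 : alpha < 2).
Hypotheses (kap0 : 0 <= kap) (kap1 : kap <= (2 - alpha) * pi).
Variable nu : probability (measurableTypeR R) R.
Hypothesis nuE : inverse_at_infinity alpha kap nu.
Local Notation xb := (xb alpha kap).
Local Notation tail := (tail alpha kap).
Local Notation branch := (branch alpha kap).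
Local Notation thb := (thb alpha kap).
Local Notation psi := (psi alpha kap).

Lemma open_range : open ([set x | branch x !=set0] : set R).
Proof.
rewrite openE => x /= bx; have [h h0 bh] := branch_nbhs alpha1 kap0 kap1 bx.
by apply/nbhs_ballP; exists h => //= s; rewrite /ball /= distrC; exact: bh.
Qed.

Lemma measurable_psi : measurable_fun (setT : set (measurableTypeR R)) psi.
Proof.
have mr : measurable ([set x | branch x !=set0] : set (measurableTypeR R)).
  by apply: open_measurable; exact: open_range.
rewrite -(setvU [set x | branch x !=set0]); apply/measurable_funU => //.
  exact: measurableC.
split.
  apply: (@eq_measurable_fun _ _ (measurableTypeR R) (measurableTypeR R) _
    (cst (0 : R))) => [x|]; last by [].
  by rewrite inE /= => nx; rewrite psi_out.
apply: open_continuous_measurable_fun; first exact: open_range.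
by move=> x; rewrite inE /=; exact: psi_continuous.
Qed.

Lemma pr_range (a c : R) : a < c -> branch a !=set0 -> branch c !=set0 ->
  pr nu `]a, c]%classic = tail (thb a) - tail (thb c).
Proof.
move=> ac ba bc; rewrite pr_ocitv ?(ltW ac)//.
have [a0 api aE] := thbP ba; have [c0 cpi cE] := thbP bc.
have [+ _] := survivalE alpha1 alpha2 kap0 kap1 nuE a0 api.
have [+ _] := survivalE alpha1 alpha2 kap0 kap1 nuE c0 cpi.
by rewrite aE cE => -> ->.
Qed.

Lemma pr_range_gt0 (a c : R) : a < c -> branch a !=set0 -> branch c !=set0 ->
  0 < pr nu `]a, c]%classic.
Proof.
move=> ac ba bc; rewrite pr_range//.
have b s : a <= s <= c -> branch s !=set0 by exact: (branch_itv alpha1 kap0 kap1).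
have [s sE h] := drv_MVT (f := fun x => tail (thb x)) (ltW ac)
  (fun s sE => is_derive_tail_thb alpha1 kap0 kap1 (b s sE)).
rewrite -opprB h mulNr opprK mulr_gt0 ?subr_gt0//.
by apply: psi_gt0; exact: b.
Qed.

Local Notation dm := (density_measure measurable_psi (psi_ge0 alpha kap)).

Lemma nu_range (a c : R) : a < c -> branch a !=set0 -> branch c !=set0 ->
  nu `]a, c]%classic = dm `]a, c]%classic.
Proof.
move=> ac ba bc; rewrite prE// pr_range// density_measureE.
rewrite integral_itv_obnd_cbnd; last first.
  by apply/measurable_EFinP; apply: measurable_funTS; exact: measurable_psi.
by rewrite (integral_psi alpha1 kap0 kap1).
Qed.

Lemma nu_density : (forall x, branch x !=set0) -> forall A, measurable A ->
  nu A = (\int[lebesgue_measure]_(x in A) (psi x)%:E)%E.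
Proof.
move=> b A mA; rewrite -(density_measureE measurable_psi (psi_ge0 alpha kap)).
apply: (measure_ext_ocitv (m1 := nu) (m2 := dm)) => // [a c ac|a c]; first exact: nu_range.
exact: (probability_lty nu (measurable_itv _)).
Qed.

(** Beyond b both measures vanish; an interval ]a, c] with a < b <= c is replaced
    by ]a, b[. *)
Lemma nu_density_below (b : R) :
  (forall x, branch x !=set0 <-> x < b) -> nu `[b, +oo[%classic = 0%E ->
  forall A, measurable A ->
  nu A = (\int[lebesgue_measure]_(x in A) (psi x)%:E)%E.
Proof.
move=> br nub A mA; rewrite -(density_measureE measurable_psi (psi_ge0 alpha kap)).
have dmb : dm `[b, +oo[%classic = 0%E.
  rewrite density_measureE; apply: integral0_eq => x /=; rewrite in_itv /= andbT => bx.
  by rewrite psi_out// br; apply/negP; rewrite -leNgt.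
have below (m : {measure set (measurableTypeR R) -> \bar R}) (B : set (measurableTypeR R)) :
    m `[b, +oo[%classic = 0%E -> measurable B -> m B = m (B `&` `]-oo, b[%classic).
  move=> mb mB.
  have {1}-> : B = (B `&` `]-oo, b[%classic) `|` (B `&` `[b, +oo[%classic).
    by rewrite -setIUr itv_setU_setT setIT.
  rewrite measureU//; [|exact: measurableI|exact: measurableI|].
    rewrite [X in (_ + X)%E](_ : _ = 0%E) ?adde0//.
    apply/eqP; rewrite eq_le measure_ge0 andbT -mb le_measure// ?inE//.
    exact: measurableI.
  apply/seteqP; split => // x [] [_ +] [_]; rewrite /= !in_itv /= andbT => h.
  by rewrite leNgt h.
apply: (measure_ext_ocitv (m1 := nu) (m2 := dm)) => // [a c ac|a c]; last exact: (probability_lty nu (measurable_itv _)).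
have [cb|bc] := ltP c b.
  by apply: nu_range; rewrite ?br//; exact: lt_trans cb.
rewrite (below nu)// (below dm)//.
have -> : `]a, c]%classic `&` `]-oo, b[%classic = `]a, b[%classic :> set R.
  apply/seteqP; split => x /=; rewrite !in_itv /=.
    by move=> [/andP[-> _] ->].
  by move=> /andP[-> xb]; rewrite xb (le_trans (ltW xb)).
have [ab|ba] := ltP a b; last by rewrite set_itv_ge ?bnd_simp -?leNgt// !measure0.
apply: measure_ext_open => // d ad db; apply: nu_range; rewrite ?br//.
Qed.

End identification.

(** * The three cases *)

Section stable_cases.
Context {R : realType}.
Variable alpha : R.
Hypotheses (alpha1 : 1 < alpha) (alpha2 : alpha < 2).

Let top_gt0 : 0 < (2 - alpha) * pi.
Proof. by rewrite mulr_gt0 ?subr_gt0 ?pi_gt0. Qed.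

Lemma branch_interior (kap x : R) : 0 < kap -> kap < (2 - alpha) * pi ->
  branch alpha kap x !=set0.
Proof.
move=> k0 k1.
have [t1 [h1 h1' x1]] := xb_unbounded alpha1 x k0 (ltW k1).
have [t2 [h2 h2' x2]] := xb_unbounded_below alpha1 x (ltW k0) k1.
have [th [th0 thpi <-]] := xb_surj alpha1 (ltW k0) (ltW k1) h1 h1' h2 h2' (ltW x1) (ltW x2).
by exists th.
Qed.

Lemma branch_extreme (x : R) : branch alpha 0 x !=set0 <-> x < edge alpha.
Proof.
split=> [[th [th0 thpi <-]]|xe]; first exact: xb_lt_edge.
have [t1 [h1 h1' _ x1]] := xb_near_edge alpha1 alpha2 xe ltr01.
have [t2 [h2 h2' x2]] := xb_unbounded_below alpha1 x (lexx 0) top_gt0.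
have [th [th0 thpi <-]] := xb_surj alpha1 (lexx 0) (ltW top_gt0) h1 h1' h2 h2' (ltW x1) (ltW x2).
by exists th.
Qed.

Section extreme.
Variable nu : probability (measurableTypeR R) R.
Hypothesis nuE : inverse_at_infinity alpha 0 nu.

(** The mass beyond xb th is at most th / pi for small th. *)
Lemma small_tail (e : R) : 0 < e -> exists th, [/\ 0 < th, th < pi,
  xb alpha 0 th < edge alpha & tail alpha 0 th <= e].
Proof.
move=> e0; have a0 : 0 < alpha by exact: lt_trans ltr01 alpha1.
have d0 : 0 < Num.min (pi / alpha) (e * pi).
  by rewrite lt_min divr_gt0 ?pi_gt0//= mulr_gt0 ?pi_gt0.
have e1 : edge alpha - 1 < edge alpha by rewrite gtrBl.
have [th [th0 thpi + _]] := xb_near_edge alpha1 alpha2 e1 d0.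
rewrite lt_min => /andP[h1 h2]; exists th; split => //; first exact: xb_lt_edge.
apply: (le_trans (tail_le alpha1 th0 h1)).
by rewrite ler_pdivrMr ?pi_gt0// ltW.
Qed.

Lemma pr_edge : pr nu `[edge alpha, +oo[%classic = 0.
Proof.
apply/eqP; rewrite eq_le pr_ge0 ?andbT; last exact: measurable_itv.
apply/ler_addgt0Pr => e e0; rewrite add0r.
have [th [th0 thpi le te]] := small_tail e0.
have [h _] := survivalE alpha1 alpha2 (lexx 0) (ltW top_gt0) nuE th0 thpi.
apply: (le_trans _ te); rewrite -h; apply: pr_le; [exact: measurable_itv|exact: measurable_itv|].
by move=> x /=; rewrite !in_itv /= !andbT; exact: lt_le_trans.
Qed.

Lemma extreme_support : measure_support nu = [set x | x <= edge alpha].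
Proof.
apply/seteqP; split => x /=.
- move=> supp; rewrite leNgt; apply/negP => ex.
  have : (0 < nu `]edge alpha, +oo[%classic)%E.
    by apply: supp; [exact: interval_open|rewrite /= in_itv /= ex].
  rewrite prE; last exact: measurable_itv.
  rewrite lte_fin ltNge => /negP; apply; rewrite -pr_edge.
  apply: pr_le; [exact: measurable_itv|exact: measurable_itv|].
  by move=> y /=; rewrite !in_itv /= !andbT; exact: ltW.
- move=> xe U oU Ux.
  have /nbhs_ballP[e /= e0 eU] : nbhs x U by exact: open_nbhs_nbhs.
  have h1 : x - e / 2 < x - e / 4 by rewrite ltrD2l ltrN2; lra.
  have h2 : x - e / 4 < edge alpha by apply: lt_le_trans xe; rewrite gtrBl divr_gt0.
  have b1 := (branch_extreme _).2 (lt_trans h1 h2).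
  have b2 := (branch_extreme _).2 h2.
  have := pr_range_gt0 alpha1 alpha2 (lexx 0) (ltW top_gt0) nuE h1 b1 b2.
  rewrite -lte_fin -prE; last exact: measurable_itv.
  move=> /lt_le_trans; apply; apply: le_measure; rewrite ?inE.
  + exact: measurable_itv.
  + exact: open_measurable.
  + move=> y /=; rewrite in_itv /= => /andP[y1 y2]; apply: eU.
    by rewrite /ball /= ger0_norm; lra.
Qed.

Lemma extreme_density : has_density_on nu [set x | x <= edge alpha] (psi alpha 0).
Proof.
split.
- apply: measurable_funTS; exact: (measurable_psi alpha1 (lexx 0) (ltW top_gt0)).
- by move=> x _; exact: psi_ge0.
- move=> A mA; rewrite integral_mkcondr.
  have -> : (fun x => (psi alpha 0 x)%:E) \_ [set x | x <= edge alpha]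
      = (fun x => (psi alpha 0 x)%:E).
    apply/funext => x; rewrite patchE; case: ifPn => //; rewrite notin_setE /= => nx.
    rewrite psi_out// => /branch_extreme xe; apply: nx; exact: ltW.
  apply: (nu_density_below alpha1 alpha2 (lexx 0) (ltW top_gt0) nuE branch_extreme) => //.
  by rewrite prE ?pr_edge//; exact: measurable_itv.
Qed.

(** By xb_reflect and tail_reflect, nu1(]- y, oo[) = 1 - nu([y, oo[) for every
    boundary point y of nu; beyond the edge both sides are 1. *)
Lemma survival_reflect (nu1 : probability (measurableTypeR R) R) (x : R) :
  inverse_at_infinity alpha ((2 - alpha) * pi) nu1 ->
  pr nu1 `]x, +oo[%classic = 1 - pr nu `[- x, +oo[%classic.
Proof.
move=> nu1E.
have surv th : 0 < th -> th < pi ->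
    pr nu1 `]- xb alpha 0 th, +oo[%classic = 1 - tail alpha 0 th.
  move=> th0 thpi; have h0 : 0 < pi - th by rewrite subr_gt0.
  have h1 : pi - th < pi by rewrite gtrBl.
  have [+ _] := survivalE alpha1 alpha2 (ltW top_gt0) (lexx _) nu1E h0 h1.
  have := @xb_reflect _ _ alpha1 0 th (lexx 0) (ltW top_gt0) th0 thpi.
  by have := tail_reflect alpha1 0 th; rewrite !subr0 => -> ->.
have [xe|ex] := ltP (- x) (edge alpha).
  have /thbP[th0 thpi xE] := (branch_extreme _).2 xe.
  have [_ +] := survivalE alpha1 alpha2 (lexx 0) (ltW top_gt0) nuE th0 thpi.
  by have := surv _ th0 thpi; rewrite xE opprK => -> ->.
have -> : pr nu `[- x, +oo[%classic = 0.
  apply/eqP; rewrite eq_le pr_ge0 ?andbT; last exact: measurable_itv.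
  rewrite -pr_edge; apply: pr_le; [exact: measurable_itv|exact: measurable_itv|].
  by move=> y /=; rewrite !in_itv /= !andbT; exact: le_trans.
rewrite subr0; apply/eqP; rewrite eq_le; apply/andP; split.
  rewrite -lee_fin -prE; last exact: measurable_itv.
  by apply: probability_le1; exact: measurable_itv.
apply/ler_addgt0Pr => e e0; have [th [th0 thpi le te]] := small_tail e0.
rewrite -lerBlDr; apply: (@le_trans _ _ (1 - tail alpha 0 th)); first by rewrite lerD2l lerN2.
rewrite -surv//; apply: pr_le; [exact: measurable_itv|exact: measurable_itv|].
move=> y /=; rewrite !in_itv /= !andbT; apply: le_lt_trans.
by rewrite lerNr (le_trans _ ex)// ltW.
Qed.

End extreme.

Lemma extreme_reflection (nu0 nu1 : probability (measurableTypeR R) R) :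
  inverse_at_infinity alpha 0 nu0 -> inverse_at_infinity alpha ((2 - alpha) * pi) nu1 ->
  forall A : set (measurableTypeR R), measurable A ->
    nu1 A = pushforward nu0 (fun t : R => - t) A.
Proof.
move=> nu0E nu1E A mA.
have mneg : measurable_fun [set: measurableTypeR R]
    ((fun t => - t) : measurableTypeR R -> measurableTypeR R).
  exact: measurable_funN.
pose neg : {mfun measurableTypeR R >-> measurableTypeR R} :=
  HB.pack ((fun t => - t) : measurableTypeR R -> measurableTypeR R)
    (isMeasurableFun.Build _ _ _ _ _ mneg).
have -> : pushforward nu0 (fun t : R => - t) A = distribution nu0 neg A by [].
apply: probability_ext => // x; rewrite (survival_reflect nu0E x nu1E).
have -> : pr (distribution nu0 neg) `]x, +oo[%classic = pr nu0 `]-oo, - x[%classic.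
  rewrite /pr /distribution /pushforward /=; congr (fine (nu0 _)).
  by apply/seteqP; split => y /=; rewrite !in_itv /= andbT ltrNr.
by rewrite -setCitvr pr_setC//; exact: measurable_itv.
Qed.

End stable_cases.

Unset Implicit Arguments.

Theorem propositionA1p2 (R : realType) (alpha : R)
    (alpha_gt1 : 1 < alpha) (alpha_lt2 : alpha < 2) :
  [/\ (forall (rho : R) (nu : probability (measurableTypeR R) R),
        0 < rho -> rho < 1 -> is_free_stable alpha rho nu ->
        let s (theta : R) := sin ((2 - alpha) * rho * pi + (alpha - 1) * theta) in
        let eqn (x theta : R) :=
          [/\ 0 < theta, theta < pi &
            x = sin theta `^ (- alpha^-1) * s theta `^ (alpha^-1 - 1)
                * sin ((2 - alpha) * rho * pi + alpha * theta)] in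
        (forall x : R, exists! theta : R, eqn x theta) /\
        exists psi : R -> R,
          [/\ has_density_on nu setT psi,
              forall x : R, 0 < psi x,
              forall x : R, real_analytic_at psi x &
              forall x theta : R, eqn x theta ->
                psi x = pi^-1 * sin theta `^ (1 + alpha^-1)
                        * s theta `^ (- alpha^-1)]),
      (forall nu : probability (measurableTypeR R) R,
        is_free_stable alpha 0 nu ->
        let b : R := alpha * (alpha - 1) `^ (alpha^-1 - 1) in
        let s (theta : R) := sin ((alpha - 1) * theta) in
        let eqn (x theta : R) :=
          [/\ 0 < theta, theta < pi &
            x = sin theta `^ (- alpha^-1) * s theta `^ (alpha^-1 - 1)
                * sin (alpha * theta)] in
        [/\ measure_support nu = [set x : R | x <= b],
            (forall x : R, x < b -> exists! theta : R, eqn x theta) &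
            exists psi : R -> R,
              [/\ has_density_on nu [set x : R | x <= b] psi,
                  forall x : R, x < b -> real_analytic_at psi x &
                  forall x theta : R, x < b -> eqn x theta ->
                    psi x = pi^-1 * sin theta `^ (1 + alpha^-1)
                            * s theta `^ (- alpha^-1)]]) &
      (forall nu0 nu1 : probability (measurableTypeR R) R,
        is_free_stable alpha 0 nu0 -> is_free_stable alpha 1 nu1 ->
        forall A : set (measurableTypeR R), measurable A ->
          nu1 A = pushforward nu0 (fun t : R => - t) A)].
Proof.
have top : 0 < (2 - alpha) * pi by rewrite mulr_gt0 ?subr_gt0 ?pi_gt0.
have zero (nu : probability (measurableTypeR R) R) :
    is_free_stable alpha 0 nu -> inverse_at_infinity alpha 0 nu.
  by move=> /free_stable_inverse; rewrite mulr0 mul0r.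
split.
- move=> rho nu rho0 rho1 /free_stable_inverse nuE s eqn.
  set kap := (2 - alpha) * rho * pi in s eqn nuE *.
  have kap0 : 0 < kap by rewrite !mulr_gt0 ?subr_gt0 ?pi_gt0.
  have kap1 : kap < (2 - alpha) * pi.
    by rewrite /kap -mulrA ltr_pM2l ?subr_gt0// gtr_pMl ?pi_gt0.
  have eqnP x theta : eqn x theta <-> branch alpha kap x theta.
    by split=> -[h1 h2 h3]; split=> //; move: h3;
      rewrite (xbE alpha_gt1 (ltW kap0) (ltW kap1) h1 h2) => ->.
  have bx x := branch_interior alpha_gt1 x kap0 kap1.
  split.
    move=> x; have [theta bt] := bx x; exists theta; split; first exact/eqnP.
    move=> theta' /eqnP [h1 h2 h3]; have [g1 g2 g3] := bt.
    by apply: (xb_inj alpha_gt1 (ltW kap0) (ltW kap1)) => //; rewrite g3.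
  exists (psi alpha kap); split.
  + split; first exact: (measurable_psi alpha_gt1 (ltW kap0) (ltW kap1)).
      by move=> x _; exact: psi_ge0.
    move=> A mA; rewrite setIT.
    exact: (nu_density alpha_gt1 alpha_lt2 (ltW kap0) (ltW kap1) nuE bx).
  + by move=> x; exact: psi_gt0.
  + by move=> x; exact: (psi_analytic alpha_gt1 alpha_lt2 (ltW kap0) (ltW kap1)).
  + move=> x theta /eqnP bt; rewrite (psiE alpha_gt1 (ltW kap0) (ltW kap1) bt).
    by have [h1 h2 _] := bt; rewrite (densE alpha_gt1 (ltW kap0) (ltW kap1) h1 h2).
- move=> nu /zero nuE b s eqn.
  have sE theta : s theta = sa alpha 0 theta by rewrite /sa add0r.
  have eqnP x theta : eqn x theta <-> branch alpha 0 x theta.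
    by split=> -[h1 h2 h3]; split=> //; move: h3;
      rewrite (xbE alpha_gt1 (lexx 0) (ltW top) h1 h2) add0r -sE => ->.
  split; first exact: (extreme_support alpha_gt1 alpha_lt2 nuE).
    move=> x /(branch_extreme alpha_gt1 alpha_lt2) [theta bt].
    exists theta; split; first exact/eqnP.
    move=> theta' /eqnP [h1 h2 h3]; have [g1 g2 g3] := bt.
    by apply: (xb_inj alpha_gt1 (lexx 0) (ltW top)) => //; rewrite g3.
  exists (psi alpha 0); split.
  + exact: (extreme_density alpha_gt1 alpha_lt2 nuE).
  + move=> x /(branch_extreme alpha_gt1 alpha_lt2) bx.
    exact: (psi_analytic alpha_gt1 alpha_lt2 (lexx 0) (ltW top)).
  + move=> x theta _ /eqnP bt; rewrite (psiE alpha_gt1 (lexx 0) (ltW top) bt) sE.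
    by have [h1 h2 _] := bt; rewrite (densE alpha_gt1 (lexx 0) (ltW top) h1 h2).
- move=> nu0 nu1 /zero nu0E /free_stable_inverse; rewrite mulr1 => nu1E.
  exact: (extreme_reflection alpha_gt1 alpha_lt2 nu0E nu1E).
Qed.
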